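(* Let $m\ge1$ and $0\le q\le m$ be integers, let $\mu:=(2^{(q)},1^{(2m+1-2q)},0^{(q)})$, and let $F\preceq F'\preceq A_{B_m}$ be subfacets of the base alcove. Then $$\mathrm{Adm}_{F',F,B_m}(\mu)=\mathrm{Adm}^{\mathrm{vert}}_{F',F,B_m}(\mu),$$ i.e. an element of $W_{F',B_m}\backslash\widetilde W_{B_m}/W_{F,B_m}$ is $\mu$-admissible if and only if it is $\mu$-vertexwise admissible.
   Context: Notation. $(d^{(i)},e^{(j)},\dots)$ denotes the vector with $d$ repeated $i$ times, then $e$ repeated $j$ times, etc. $i^*:=2m+2-i$ for $i\in\{1,\dots,2m+1\}$. Root datum of split $GO_{2m+1}$. $X_*:=\{x\in\mathbb Z^{2m+1}: x_i+x_{i^*}=2x_{m+1}\ \forall i\}$; $Q^\vee_{B_m}:=\{x\in X_*: x_i+x_{i^*}=0\ \forall i,\ x_1+\dots+x_m\text{ even}\}$; $S_{2m+1}^*:=\{\sigma\in S_{2m+1}:\sigma(i^* )=\sigma(i)^*\ \forall i\}$. $\widetilde W_{B_m}:=X_*\rtimes S_{2m+1}^*$ acts on $\mathcal A:=X_*\otimes\mathbb R\subset\mathbb R^{2m+1}$ by affine transformations, $X_*$ by translations ($t_\lambda$) and $S^*_{2m+1}$ by permuting coordinates; $W_{\mathrm{aff},B_m}:=Q^\vee_{B_m}\rtimes S_{2m+1}^*$. The affine root hyperplanes are $\{x_i-x_j=d\}$, $j\ne i,i^*$, $d\in\mathbb Z$ ($i$ or $j$ may equal $m+1$); they determine facets and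 alcoves in $\mathcal A$ (minimal facets are lines parallel to $(1,\dots,1)$). The base alcove is $A_{B_m}:=\{x\in\mathcal A: x_1,\,x_{2m+1}-1<x_2<x_3<\dots<x_{m+1}\}$. For facets, $\mathbf f\preceq\mathbf f'$ means $\mathbf f\subset\overline{\mathbf f'}$. For a facet $F$, $W_{F,B_m}$ is the stabilizer (equivalently pointwise fixer) of $F$ in $W_{\mathrm{aff},B_m}$. Bruhat order. $W_{\mathrm{aff},B_m}$ is a Coxeter group generated by the reflections across the walls of $A_{B_m}$; with $\Omega$ the stabilizer of $A_{B_m}$ in $\widetilde W_{B_m}$, $\widetilde W_{B_m}=W_{\mathrm{aff},B_m}\rtimes\Omega$, $\ell(x\tau)=\ell(x)$ and $x\tau\le x'\tau'$ iff $\tau=\tau'$ and $x\le x'$. For subfacets $F_1,F_2\preceq A_{B_m}$ each double coset in $W_{F_1,B_m}\backslash\widetilde W_{B_m}/W_{F_2,B_m}$ contains a unique element of minimal length, and the Bruhat order on double cosets is defined by comparing these. Admissibility. $\mathrm{Adm}_{F_1,F_2,B_m}(\mu)$ is the set of $w\in W_{F_1,B_m}\backslash\widetilde W_{B_m}/W_{F_2,B_m}$ with $w\le W_{F_1,B_m}t_\lambda W_{F_2,B_m}$ for some $\lambda\in S^*_{2m+1}\mu$. For $F\preceq F'\preceq A_{B_m}$ and a minimal subfacet $\mathbf v\preceq F$, let $\rho_{\mathbf v}:W_{F',B_m}\backslash\widetilde W_{B_m}/W_{F,B_m}\to W_{\mathbf v,B_m}\backslash\widetilde W_{B_m}/W_{\mathbf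 v,B_m}$ be the natural map. Then $\mathrm{Adm}^{\mathrm{vert}}_{F',F,B_m}(\mu):=\bigcap_{\mathbf v}\rho_{\mathbf v}^{-1}(\mathrm{Adm}_{\mathbf v,\mathbf v,B_m}(\mu))$, the intersection over all minimal subfacets $\mathbf v$ of $F$. *)

(* Defs.v *)
From HB Require Import structures.
From Stdlib Require Import Relation_Operators.
From mathcomp Require Import all_boot all_order all_algebra all_fingroup.
From mathcomp Require Import all_classical all_reals all_analysis.
Import Order.TTheory GRing.Theory Num.Theory.
Import numFieldNormedType.Exports.

Set Implicit Arguments.
Unset Strict Implicit.
Unset Printing Implicit Defensive.

Local Open Scope classical_set_scope.
Local Open Scope ring_scope.

(* Z^n \rtimes S_n.  The pair (lambda, sigma) stands for the affine map
   x |-> lambda + sigma x, where (sigma x)_i = x_(sigma^-1 i); the group law is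
   composition of maps.  Beware that the product s * t of mathcomp permutations
   means "s first, then t", whence the swapped product in [zaff_mul]. *)
Record zaff (n : nat) := ZAff { zaff_tr : 'rV[int]_n ; zaff_lin : 'S_n }.

Definition zaff_pair n (w : zaff n) := (zaff_tr w, zaff_lin w).
Definition pair_zaff n (p : 'rV[int]_n * 'S_n) := ZAff p.1 p.2.
Lemma zaff_pairK n : cancel (@zaff_pair n) (@pair_zaff n).
Proof. by case. Qed.

HB.instance Definition _ n := Choice.copy (zaff n) (can_type (@zaff_pairK n)).

Definition permv (K : Type) n (s : 'S_n) (x : 'rV[K]_n) : 'rV[K]_n :=
  col_perm s^-1%g x.

Definition zaff_act (K : pzRingType) n (w : zaff n) (x : 'rV[K]_n) : 'rV[K]_n :=
  map_mx intr (zaff_tr w) + permv (zaff_lin w) x.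

Definition zaff_one n : zaff n := ZAff 0 1%g.
Definition zaff_mul n (w w' : zaff n) : zaff n :=
  ZAff (zaff_tr w + permv (zaff_lin w) (zaff_tr w'))
       (zaff_lin w' * zaff_lin w)%g.
Definition zaff_inv n (w : zaff n) : zaff n :=
  ZAff (- permv (zaff_lin w)^-1%g (zaff_tr w)) (zaff_lin w)^-1%g.

Lemma permvM (K : Type) n (s t : 'S_n) (x : 'rV[K]_n) :
  permv (t * s)%g x = permv s (permv t x).
Proof. by apply/rowP => i; rewrite !mxE invMg permM. Qed.

Lemma permv1 (K : Type) n (x : 'rV[K]_n) : permv 1%g x = x.
Proof. by apply/rowP => i; rewrite !mxE invg1 perm1. Qed.

Lemma permvD (K : nmodType) n (s : 'S_n) (x y : 'rV[K]_n) :
  permv s (x + y) = permv s x + permv s y.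
Proof. by apply/rowP => i; rewrite !mxE. Qed.

Lemma zaff_mulA n : associative (@zaff_mul n).
Proof.
move=> u v w; rewrite /zaff_mul /=.
by rewrite permvD addrA permvM mulgA.
Qed.

Lemma zaff_mul1 n : left_id (@zaff_one n) (@zaff_mul n).
Proof. by case=> l s; rewrite /zaff_mul /= add0r permv1 mulg1. Qed.

Lemma zaff_mulr1 n : right_id (@zaff_one n) (@zaff_mul n).
Proof.
case=> l s; rewrite /zaff_mul /= mul1g; congr ZAff.
by apply/rowP => i; rewrite !mxE addr0.
Qed.

Lemma zaff_mulV n : left_inverse (@zaff_one n) (@zaff_inv n) (@zaff_mul n).
Proof. by case=> l s; rewrite /zaff_mul /= addNr mulgV. Qed.

Lemma zaff_mulrV n : right_inverse (@zaff_one n) (@zaff_inv n) (@zaff_mul n).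
Proof.
case=> l s; rewrite /zaff_mul /= mulVg; congr ZAff.
by apply/rowP => i; rewrite !mxE invgK permKV subrr.
Qed.

HB.instance Definition _ n := isGroup.Build (zaff n)
  (@zaff_mulA n) (@zaff_mul1 n) (@zaff_mulr1 n)
  (@zaff_mulV n) (@zaff_mulrV n).

Lemma zaff_actM (K : pzRingType) n (w w' : zaff n) (x : 'rV[K]_n) :
  zaff_act (w * w')%g x = zaff_act w (zaff_act w' x).
Proof.
rewrite /zaff_act /= permvM permvD addrA; congr (_ + _).
by apply/rowP => i; rewrite !mxE intrD.
Qed.

Definition transl n (l : 'rV[int]_n) : zaff n := ZAff l 1%g.

(* Coordinates are numbered from 0 to 2m, so that i^* = 2m + 2 - i becomes
   [rev_ord i], and the index m + 1 becomes [mid m]. *)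
Definition mid (m : nat) : 'I_(m.*2.+1) := inord m.

Definition balanced (K : nmodType) m : set 'rV[K]_(m.*2.+1) :=
  [set x | forall i, x 0 i + x 0 (rev_ord i) = x 0 (mid m) *+ 2].
Arguments balanced K m _ : clear implicits.

Definition Xstar m : set 'rV[int]_(m.*2.+1) := balanced int m.

Definition coroot_lattice m : set 'rV[int]_(m.*2.+1) :=
  [set x | [/\ Xstar x, forall i, x 0 i + x 0 (rev_ord i) = 0
             & (2 %| (\sum_(i < m.*2.+1 | (i < m)%N) x 0 i))%Z]].

Definition Sstar m : set 'S_(m.*2.+1) :=
  [set s | forall i, s (rev_ord i) = rev_ord (s i)].

Definition Wext m : set (zaff m.*2.+1) :=
  [set w | Xstar (zaff_tr w) /\ Sstar (zaff_lin w)].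

Definition Waff m : set (zaff m.*2.+1) :=
  [set w | coroot_lattice (zaff_tr w) /\ Sstar (zaff_lin w)].

Definition apt (R : realType) m : set 'rV[R]_(m.*2.+1) := balanced R m.

Definition is_root m (i j : 'I_(m.*2.+1)) : bool :=
  (j != i) && (j != rev_ord i).

Definition root_hyperplane (R : realType) m (i j : 'I_(m.*2.+1)) (d : int) :
    set 'rV[R]_(m.*2.+1) :=
  [set x | apt x /\ x 0 i - x 0 j = d%:~R].
Arguments root_hyperplane R {m} i j d _.

Definition root_hyperplanes (R : realType) m : set (set 'rV[R]_(m.*2.+1)) :=
  [set H | exists i j d, is_root i j /\ H = root_hyperplane R i j d].

Definition same_side (R : realType) m (x y : 'rV[R]_(m.*2.+1)) : Prop :=
  forall (i j : 'I_(m.*2.+1)) (d : int), is_root i j ->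
    Num.sg (x 0 i - x 0 j - d%:~R) = Num.sg (y 0 i - y 0 j - d%:~R).

Definition is_facet (R : realType) m (f : set 'rV[R]_(m.*2.+1)) : Prop :=
  exists2 x, apt x & f = [set y | apt y /\ same_side x y].

Definition subfacet (R : realType) m (f f' : set 'rV[R]_(m.*2.+1)) : Prop :=
  f `<=` closure f'.

Definition is_minimal_subfacet (R : realType) m
    (v f : set 'rV[R]_(m.*2.+1)) : Prop :=
  [/\ is_facet v, subfacet v f
    & forall g, is_facet g -> subfacet g v -> g = v].

Definition base_alcove (R : realType) m : set 'rV[R]_(m.*2.+1) :=
  [set x | [/\ apt x, x 0 ord0 < x 0 (inord 1), x 0 ord_max - 1 < x 0 (inord 1)
             & forall i j : 'I_(m.*2.+1),
                 (1 <= i)%N -> (i < j)%N -> (j <= m)%N -> x 0 i < x 0 j]].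
Arguments base_alcove R m _ : clear implicits.

Definition stab (R : realType) m (G : set (zaff m.*2.+1))
    (f : set 'rV[R]_(m.*2.+1)) : set (zaff m.*2.+1) :=
  [set w | G w /\ zaff_act w @` f = f].

Definition facet_stab (R : realType) m (f : set 'rV[R]_(m.*2.+1)) :=
  stab (@Waff m) f.

Definition Omega (R : realType) m : set (zaff m.*2.+1) :=
  stab (@Wext m) (base_alcove R m).

Definition facet_support (R : realType) m (f : set 'rV[R]_(m.*2.+1)) :
    set 'rV[R]_(m.*2.+1) :=
  [set x | apt x /\ forall H, root_hyperplanes H -> f `<=` H -> H x].

Definition is_wall (R : realType) m (C H : set 'rV[R]_(m.*2.+1)) : Prop :=
  root_hyperplanes H /\
  exists f, [/\ is_facet f, subfacet f C & facet_support f = H].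

Definition dotv (R : realType) n (x y : 'rV[R]_n) : R :=
  \sum_i x 0 i * y 0 i.

(* The orthogonal reflection of the apartment across H: the midpoint of x and
   w x lies on H, and w x - x is orthogonal to the directions of H. *)
Definition is_reflection_across (R : realType) m
    (H : set 'rV[R]_(m.*2.+1)) (w : zaff m.*2.+1) : Prop :=
  forall x : 'rV[R]_(m.*2.+1), apt x ->
    H (2^-1 *: (x + zaff_act w x)) /\
    forall y z, H y -> H z -> dotv (zaff_act w x - x) (y - z) = 0.

Definition simple_refl (R : realType) m : set (zaff m.*2.+1) :=
  [set s | Waff s /\
     exists2 H, is_wall (base_alcove R m) H & is_reflection_across H s].

Definition affine_refl (R : realType) m : set (zaff m.*2.+1) :=
  [set t | exists s w, [/\ simple_refl R s, Waff w & t = (w * s * w^-1)%g]].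

Definition is_word_of (R : realType) m (w : zaff m.*2.+1)
    (s : seq (zaff m.*2.+1)) : Prop :=
  (forall x, x \in s -> simple_refl R x) /\ w = (\prod_(x <- s) x)%g.

Definition len_aff (R : realType) m (w : zaff m.*2.+1) : nat :=
  xget 0%N [set k | (exists2 s, is_word_of R w s & size s = k) /\
                    forall s, is_word_of R w s -> (k <= size s)%N].

Definition bruhat_aff (R : realType) m :
    zaff m.*2.+1 -> zaff m.*2.+1 -> Prop :=
  clos_refl_trans (zaff m.*2.+1) (fun x y =>
    [/\ Waff x, (len_aff R x < len_aff R y)%N
      & exists2 t, affine_refl R t & y = (x * t)%g]).

Definition len (R : realType) m (w : zaff m.*2.+1) : nat :=
  xget 0%N [set k | exists x tau, [/\ Waff x, Omega R tau, w = (x * tau)%g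
                                    & k = len_aff R x]].

Definition bruhat (R : realType) m (w w' : zaff m.*2.+1) : Prop :=
  exists x x' tau, [/\ Waff x, Waff x', Omega R tau,
    w = (x * tau)%g /\ w' = (x' * tau)%g & bruhat_aff R x x'].

Definition dcoset (R : realType) m (F1 F2 : set 'rV[R]_(m.*2.+1))
    (w : zaff m.*2.+1) : set (zaff m.*2.+1) :=
  [set z | exists a b,
     [/\ facet_stab F1 a, facet_stab F2 b & z = (a * w * b)%g]].

Definition dcosets (R : realType) m (F1 F2 : set 'rV[R]_(m.*2.+1)) :
    set (set (zaff m.*2.+1)) :=
  [set D | exists2 w, Wext w & D = dcoset F1 F2 w].

Definition is_min_length (R : realType) m (D : set (zaff m.*2.+1))
    (w : zaff m.*2.+1) : Prop :=
  D w /\ forall z, D z -> (len R w <= len R z)%N.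

Definition dcoset_bruhat (R : realType) m (D D' : set (zaff m.*2.+1)) : Prop :=
  exists w w', [/\ is_min_length R D w, is_min_length R D' w' & bruhat R w w'].

Definition Adm (R : realType) m (F1 F2 : set 'rV[R]_(m.*2.+1))
    (mu : 'rV[int]_(m.*2.+1)) : set (set (zaff m.*2.+1)) :=
  [set D | dcosets F1 F2 D /\
     exists2 s, Sstar s & dcoset_bruhat R D (dcoset F1 F2 (transl (permv s mu)))].

(* W_v \ W / W_v is reached from D = W_F' w W_F by W_v D W_v = W_v w W_v, as
   W_F' and W_F are contained in W_v when v is a subfacet of F and of F'. *)
Definition dcoset_proj (R : realType) m (v : set 'rV[R]_(m.*2.+1))
    (D : set (zaff m.*2.+1)) : set (zaff m.*2.+1) :=
  \bigcup_(w in D) dcoset v v w.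

Definition AdmVert (R : realType) m (F' F : set 'rV[R]_(m.*2.+1))
    (mu : 'rV[int]_(m.*2.+1)) : set (set (zaff m.*2.+1)) :=
  dcosets F' F `&`
  \bigcap_(v in [set v | is_minimal_subfacet v F])
    (@dcoset_proj R m v @^-1` Adm v v mu).

Definition mu_q (m q : nat) : 'rV[int]_(m.*2.+1) :=
  \row_i (if (i < q)%N then 2 else if (i < m.*2.+1 - q)%N then 1 else 0).

(* Main.v *)
(* The proof works for an arbitrary cocharacter [mu] and follows the "obtuse cone"
   idea of Haines and He.  Elements [x] of the extended affine Weyl group are viewed
   as alcoves [x A].  For a regular direction [th] let <=_th be the Bruhat order seen
   from a base alcove at infinity in direction [- th]: it is generated by
   reflections going from the [th]-negative to the [th]-positive side.

   If [x] is [mu]-admissible, then [x <=_th t_la] for every [th], where [la] is the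
   [th]-dominant conjugate of [mu].  This relation is stable under replacing [x] by
   [a x b] with [a], [b] fixing a vertex [v], provided [t_la] is considered modulo
   the fixer of [v] on the right.  Hence if [x] is vertexwise admissible along the
   facet [F], then [x <=_th t_la] holds modulo the fixer of every vertex of [F].

   Take [x] minimal in [x W_F] and [th] pointing from [A] to [x F].  Then [x] is
   minimal in [x W_F] also for <=_th, and Deodhar's criterion yields
   [x <=_th t_la].  Being a relation between finitely many alcoves, this is the
   Bruhat order from the base alcove translated by [- N th], [N] large; as [A] lies
   on a minimal gallery from there to [x A], it implies [x <= t_la]. *)

From Stdlib Require Import Relation_Operators.
From mathcomp Require Import all_boot all_order all_algebra all_fingroup.
From mathcomp Require Import all_classical all_reals all_analysis.
From mathcomp Require Import zify ring lra.
Require Import Defs.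
Import Order.TTheory GRing.Theory Num.Theory.
Import numFieldNormedType.Exports.

Set Implicit Arguments.
Unset Strict Implicit.
Unset Printing Implicit Defensive.

Local Open Scope ring_scope.

(** * Affine roots and reflections *)

(** Two points shape the argument. Sets of separating hyperplanes are never formed: the
    combinatorics is read off the signs [pos] of affine roots at one rational point of the base
    alcove, and inductions run on the squared displacement [displ_norm] of that point. Length enters
    only when the result is translated back to the definitions. The other point is the left factor.
    Let [a], [b] fix a vertex and let [a x b] be admissible. Taking the direction [a th] for it and
    multiplying by [a^-1] gives [x b <=_th a^-1 t_(a la) = t_la a^-1]: the linear part of [a] is
    absorbed in passing from [a la] to [la], and the remaining [a^-1] stands on the right, where it
    can be moved to the other side. This is why an admissible element is bounded in every direction,
    and why the dominant conjugate must be unique: only then do all vertices of the facet bound [x]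
    by the same [t_la]. *)

Section Roots.
Variable m : nat.
Local Notation n := m.*2.+1.
Local Notation aroot := ('I_n * 'I_n * int)%type.

Definition isroot (r : aroot) := is_root r.1.1 r.1.2.
Definition rneg (r : aroot) : aroot := (r.1.2, r.1.1, - r.2).
(* The triple [(i, j, d)] stands for the affine root x_i - x_j - d. *)
Definition rval (K : pzRingType) (r : aroot) (x : 'rV[K]_n) : K :=
  x 0 r.1.1 - x 0 r.1.2 - r.2%:~R.
Definition root_act (w : zaff n) (r : aroot) : aroot :=
  (zaff_lin w r.1.1, zaff_lin w r.1.2,
   r.2 + zaff_tr w 0 (zaff_lin w r.1.1) - zaff_tr w 0 (zaff_lin w r.1.2)).

Lemma val_mid : mid m = m :> nat.
Proof. by rewrite /mid inordK //; lia. Qed.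

Lemma rev_mid : rev_ord (mid m) = mid m.
Proof. by apply: val_inj; rewrite /= val_mid; lia. Qed.

Lemma ord_neq k (i j : 'I_k) : (i == j) = (i == j :> nat).
Proof. by []. Qed.

Lemma rval_act (K : comPzRingType) (w : zaff n) r (x : 'rV[K]_n) :
  rval (root_act w r) (zaff_act w x) = rval r x.
Proof.
rewrite /rval /zaff_act /root_act /permv !mxE !permK intrB intrD /=; ring.
Qed.

Lemma root_act1 r : root_act 1%g r = r.
Proof.
by case: r => [[i j] d]; rewrite /root_act /= !perm1 !mxE addr0 subr0.
Qed.

Lemma root_actM w w' r : root_act (w * w')%g r = root_act w (root_act w' r).
Proof.
case: r => [[i j] d]; rewrite /root_act /= /permv !mxE !permM !permK.
by congr (_, _, _); ring.
Qed.

Lemma root_actK w r : root_act w^-1%g (root_act w r) = r.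
Proof. by rewrite -root_actM mulVg root_act1. Qed.
Lemma root_actVK w r : root_act w (root_act w^-1%g r) = r.
Proof. by rewrite -root_actM mulgV root_act1. Qed.

Lemma root_act_neg w r : root_act w (rneg r) = rneg (root_act w r).
Proof. by case: r => [[i j] d]; rewrite /root_act /rneg /=; congr (_, _, _); ring. Qed.

Lemma rval_neg (K : comPzRingType) r (x : 'rV[K]_n) : rval (rneg r) x = - rval r x.
Proof. by rewrite /rval /rneg /= mulrNz; ring. Qed.

Lemma rval_actV (K : comPzRingType) (w : zaff n) r (x : 'rV[K]_n) :
  rval r (zaff_act w x) = rval (root_act w^-1%g r) x.
Proof. by rewrite -{1}(root_actVK w r) rval_act. Qed.

Lemma isroot_neg r : isroot (rneg r) = isroot r.
Proof.
case: r => [[i j] d]; rewrite /isroot /is_root /rneg /= !ord_neq /=.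
have := ltn_ord i; have := ltn_ord j; lia.
Qed.

Lemma Sstar1 : Sstar (1%g : 'S_n).
Proof. by move=> i; rewrite !perm1. Qed.
Lemma SstarM (s t : 'S_n) : Sstar s -> Sstar t -> Sstar (s * t)%g.
Proof. by move=> hs ht i; rewrite !permM hs ht. Qed.
Lemma SstarV (s : 'S_n) : Sstar s -> Sstar s^-1%g.
Proof. by move=> hs i; apply: (@perm_inj _ s); rewrite hs !permKV. Qed.
Lemma Sstar_mid (s : 'S_n) : Sstar s -> s (mid m) = mid m.
Proof.
move=> hs; apply: val_inj; have := congr1 val (hs (mid m)).
rewrite rev_mid /= val_mid; lia.
Qed.

Lemma isroot_act w r : Sstar (zaff_lin w) -> isroot (root_act w r) = isroot r.
Proof.
by move=> hs; rewrite /isroot /is_root /root_act /= -hs !(inj_eq perm_inj).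
Qed.

Lemma balancedD (K : nmodType) (x y : 'rV[K]_n) :
  balanced K m x -> balanced K m y -> balanced K m (x + y).
Proof. by move=> hx hy i; rewrite !mxE addrACA hx hy mulrnDl. Qed.

Lemma balancedN (K : zmodType) (x : 'rV[K]_n) :
  balanced K m x -> balanced K m (- x).
Proof. by move=> hx i; rewrite !mxE -opprD hx mulNrn. Qed.

Lemma balancedZ (K : comPzRingType) (c : K) (x : 'rV[K]_n) :
  balanced K m x -> balanced K m (c *: x).
Proof. by move=> hx i; rewrite !mxE -mulrDr hx mulrnAr. Qed.

Lemma balanced0 (K : nmodType) : balanced K m 0.
Proof. by move=> i; rewrite !mxE addr0 mul0rn. Qed.

Lemma balanced_perm (K : nmodType) (s : 'S_n) (x : 'rV[K]_n) :
  Sstar s -> balanced K m x -> balanced K m (permv s x).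
Proof.
move=> /SstarV hs hx i; rewrite !mxE hs hx.
by congr (x 0 _ *+ 2); rewrite Sstar_mid.
Qed.

Lemma balanced_intr (K : pzRingType) (x : 'rV[int]_n) :
  balanced int m x -> balanced K m (map_mx intr x).
Proof. by move=> hx i; rewrite !mxE -intrD hx !mulr2n intrD. Qed.

Lemma balanced_act (K : pzRingType) w (x : 'rV[K]_n) :
  Wext w -> balanced K m x -> balanced K m (zaff_act w x).
Proof.
by case=> hl hs hx; apply: balancedD; [apply: balanced_intr|apply: balanced_perm].
Qed.

Lemma Wext1 : Wext (1%g : zaff n).
Proof. by split; [exact: balanced0|exact: Sstar1]. Qed.
Lemma WextM (w w' : zaff n) : Wext w -> Wext w' -> Wext (w * w')%g.
Proof.
case=> hl hs [hl' hs']; split; last exact: SstarM.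
by apply: balancedD => //; apply: balanced_perm.
Qed.
Lemma WextV (w : zaff n) : Wext w -> Wext w^-1%g.
Proof.
case=> hl hs; split; last exact: SstarV.
by apply: balancedN; apply: balanced_perm => //; apply: SstarV.
Qed.

End Roots.

Section Reflections.
Variable m : nat.
Local Notation n := m.*2.+1.
Local Notation aroot := ('I_n * 'I_n * int)%type.

(* Write i' = rev_ord i.  On the apartment x_i - x_mid = (x_i - x_i') / 2, so the
   reflection in a short root exchanges i and i'. *)
Definition refl_lin (i j : 'I_n) : 'S_n :=
  if j == mid m then tperm i (rev_ord i) else
  if i == mid m then tperm j (rev_ord j) else
  (tperm i j * tperm (rev_ord i) (rev_ord j))%g.

(* The coroots are e_i - e_j + e_j' - e_i' for the long roots and twice this vector
   for the short ones, again with i' = rev_ord i. *)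
Definition coroot (r : aroot) : 'rV[int]_n :=
  \row_l (((l == r.1.1)%:Z + (l == rev_ord r.1.2)%:Z - (l == r.1.2)%:Z
           - (l == rev_ord r.1.1)%:Z)
          *+ (if (r.1.1 == mid m) || (r.1.2 == mid m) then 2 else 1)).

Definition refl (r : aroot) : zaff n :=
  ZAff (r.2 *: coroot r) (refl_lin r.1.1 r.1.2).

Lemma refl_linE (i j : 'I_n) : is_root i j -> i != mid m -> j != mid m ->
  forall l, refl_lin i j l = if l == i then j else if l == j then i else
    if l == rev_ord i then rev_ord j else if l == rev_ord j then rev_ord i else l.
Proof.
rewrite /is_root /refl_lin => /andP[ji jri] im jm l.
rewrite (negbTE im) (negbTE jm) permM !permE /=.
have Hi := ltn_ord i; have Hj := ltn_ord j.
have e1 : (j == rev_ord i) = false by apply: negbTE.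
have e2 : (j == rev_ord j) = false.
  by move: jm; rewrite !ord_neq val_mid /=; lia.
have e3 : (i == rev_ord i) = false.
  by move: im; rewrite !ord_neq val_mid /=; lia.
have e4 : (i == rev_ord j) = false.
  by move: jri; rewrite !ord_neq /=; lia.
have [_|li] := eqVneq l i; first by rewrite e1 e2.
by have [_|lj] := eqVneq l j; first by rewrite e3 e4.
Qed.

Lemma refl_linK (i j : 'I_n) : is_root i j -> involutive (refl_lin i j).
Proof.
move=> hij l; have [im|im] := eqVneq i (mid m).
  by rewrite /refl_lin im eqxx; case: ifP => _; rewrite tpermK.
have [jm|jm] := eqVneq j (mid m).
  by rewrite /refl_lin jm eqxx tpermK.
rewrite !(refl_linE hij im jm).
move: hij im jm; rewrite /is_root !ord_neq !val_mid /= => hij im jm.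
have Hi := ltn_ord i; have Hj := ltn_ord j; have Hl := ltn_ord l.
do !case: ifPn; rewrite ?ord_neq /=; try lia; move=> *;
  apply: val_inj => /=; lia.
Qed.

Lemma refl_linV (i j : 'I_n) : is_root i j -> (refl_lin i j)^-1%g = refl_lin i j.
Proof.
move=> /refl_linK hK; apply/permP => l.
by apply: (@perm_inj _ (refl_lin i j)); rewrite permKV hK.
Qed.

(** Checked coordinate by coordinate. Balancedness is essential: it turns x_i - x_i' into 2 (x_i -
    x_mid) for the short roots and makes the primed coordinates of a long root change by the
    opposite amount. *)
Lemma refl_lin_coroot (K : realFieldType) (x : 'rV[K]_n) r : isroot r -> balanced K m x ->
  forall l, x 0 (refl_lin r.1.1 r.1.2 l)
    = x 0 l - (x 0 r.1.1 - x 0 r.1.2) * (coroot r 0 l)%:~R.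
Proof.
case: r => [[i j] d]; rewrite /isroot /= => hij hx l; rewrite mxE /=.
rewrite rmorphMn /= !rmorphB rmorphD /=.
have hi := hx i; have hj := hx j.
have Hi := ltn_ord i; have Hj := ltn_ord j; have Hl := ltn_ord l.
have revF (k : 'I_n) : k != mid m -> ((k == rev_ord k) = false) * ((rev_ord k == k) = false)
    * ((rev_ord k == mid m) = false) * ((mid m == rev_ord k) = false)
    * ((mid m == k) = false).
  move=> km; have Hk := ltn_ord k.
  by move: km; rewrite !ord_neq !val_mid /=; do !split; lia.
have [im|im] := eqVneq i (mid m).
  have jm : j != mid m by move: hij; rewrite /is_root im => /andP[].
  rewrite /refl_lin im eqxx rev_mid (negbTE jm) permE /=.
  move: hi hj; rewrite im rev_mid => hi hj.
  have [->|lj] := eqVneq l j.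
    rewrite !(revF _ jm) (negbTE jm) /=; rewrite /= ?mulr0z ?mulr1z; lra.
  by have [->|lrj] := eqVneq l (rev_ord j);
    rewrite ?(revF _ jm) ?(negbTE jm) /= ?mulr0z ?mulr1z; lra.
have [jm|jm] := eqVneq j (mid m).
  rewrite /refl_lin jm eqxx rev_mid permE /=.
  move: hi hj; rewrite jm rev_mid => hi hj.
  have [->|lj] := eqVneq l i.
    by rewrite !(revF _ im) (negbTE im); rewrite /= ?mulr0z ?mulr1z; lra.
  by have [->|lrj] := eqVneq l (rev_ord i);
    rewrite ?(revF _ im) ?(negbTE im) /= ?mulr0z ?mulr1z; lra.
rewrite refl_linE //.
rewrite /is_root !ord_neq !val_mid /= in hij im jm.
have F : ((i == j) = false) * ((j == i) = false)
    * ((i == rev_ord j) = false) * ((j == rev_ord i) = false)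
    * ((rev_ord i == rev_ord j) = false) * ((rev_ord j == rev_ord i) = false)
    * ((i == rev_ord i) = false) * ((j == rev_ord j) = false)
    * ((rev_ord i == j) = false) * ((rev_ord j == i) = false)
    * ((rev_ord i == i) = false) * ((rev_ord j == j) = false).
  by rewrite !ord_neq /=; do !split; lia.
have [->|li] := eqVneq l i; first by rewrite !F; rewrite /= ?mulr0z ?mulr1z; lra.
have [->|lj] := eqVneq l j; first by rewrite !F; rewrite /= ?mulr0z ?mulr1z; lra.
have [->|li'] := eqVneq l (rev_ord i); first by rewrite !F; rewrite /= ?mulr0z ?mulr1z; lra.
by have [->|lj'] := eqVneq l (rev_ord j); rewrite ?F; rewrite /= ?mulr0z ?mulr1z; lra.
Qed.

Lemma rev_ord_eq (l i : 'I_n) : (rev_ord l == i) = (l == rev_ord i).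
Proof. by rewrite -[i in LHS]rev_ordK (inj_eq rev_ord_inj). Qed.

Lemma coroot_rev r l : coroot r 0 (rev_ord l) = - coroot r 0 l.
Proof. by rewrite !mxE !rev_ord_eq !rev_ordK -mulNrn; congr (_ *+ _); ring. Qed.

Lemma coroot_mid r : coroot r 0 (mid m) = 0.
Proof. by have := coroot_rev r (mid m); rewrite rev_mid; lia. Qed.

Lemma coroot_balanced r : balanced int m (coroot r).
Proof. by move=> i; rewrite coroot_rev coroot_mid subrr mul0rn. Qed.

(** A test point of the apartment with pairwise distinct coordinates: a permutation is known once
    its effect on this point is known. *)
Definition linpt : 'rV[int]_n := \row_l (l%:Z - m%:Z).

Lemma linpt_inj (i j : 'I_n) : linpt 0 i = linpt 0 j -> i = j.
Proof. by rewrite !mxE => h; apply: val_inj => /=; lia. Qed.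

Lemma linpt_rev i : linpt 0 (rev_ord i) = - linpt 0 i.
Proof. by rewrite !mxE /=; have := ltn_ord i; lia. Qed.

Lemma linpt_balanced : balanced int m linpt.
Proof. by move=> i; rewrite linpt_rev !mxE val_mid mulr2n; lia. Qed.

Lemma refl_lin_int (x : 'rV[int]_n) r : isroot r -> balanced int m x ->
  forall l, x 0 (refl_lin r.1.1 r.1.2 l) = x 0 l - (x 0 r.1.1 - x 0 r.1.2) * coroot r 0 l.
Proof.
move=> hr hx l; apply: (@intr_inj rat).
rewrite intrB intrM intrB.
by have := refl_lin_coroot hr (balanced_intr rat hx) l; rewrite !mxE.
Qed.

Lemma refl_lin_Sstar (i j : 'I_n) : is_root i j -> Sstar (refl_lin i j).
Proof.
move=> hij l; apply: linpt_inj; rewrite linpt_rev.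
have h := @refl_lin_int linpt (i, j, 0) hij linpt_balanced.
by rewrite !h coroot_rev linpt_rev; ring.
Qed.

Lemma refl_act (K : realFieldType) (x : 'rV[K]_n) r : isroot r -> balanced K m x ->
  zaff_act (refl r) x = x - rval r x *: map_mx intr (coroot r).
Proof.
move=> hr hx; apply/rowP => l; rewrite !mxE refl_linV // (refl_lin_coroot hr hx).
by rewrite /rval [coroot r]lock intrM -lock mxE; ring.
Qed.

Lemma root_coroot r : isroot r -> coroot r 0 r.1.1 - coroot r 0 r.1.2 = 2.
Proof.
case: r => [[i j] d]; rewrite /isroot /is_root !mxE !ord_neq /= !val_mid => hr.
have Hi := ltn_ord i; have Hj := ltn_ord j.
have [ij ji] : ((i == j :> nat) = false) /\ ((j == i :> nat) = false) by lia.
have [irj jri] : ((i == (n - j.+1)%N :> nat) = false)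
    /\ ((j == (n - i.+1)%N :> nat) = false) by lia.
have iri : (i == (n - i.+1)%N :> nat) = (i == m :> nat) by lia.
have jrj : (j == (n - j.+1)%N :> nat) = (j == m :> nat) by lia.
rewrite !eqxx ij ji irj jri iri jrj.
by case: (i =P m :> nat) => im; case: (j =P m :> nat) => jm //; lia.
Qed.

End Reflections.

Section ReflectionGroup.
Variable m : nat.
Local Notation n := m.*2.+1.
Local Notation aroot := ('I_n * 'I_n * int)%type.

Lemma zaff_act1 (K : pzRingType) (x : 'rV[K]_n) : zaff_act 1%g x = x.
Proof. by apply/rowP => i; rewrite !mxE add0r invg1 perm1. Qed.

Lemma sum_delta (K : pzRingType) (P : pred 'I_n) (x : 'rV[K]_n) (i : 'I_n) :
  \sum_(l | P l) (l == i)%:R * x 0 l = (P i)%:R * x 0 i.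
Proof.
case: (boolP (P i)) => Pi.
  rewrite (bigD1 i) //= eqxx big1 ?addr0 // => l /andP[_ /negbTE->].
  by rewrite mul0r.
rewrite mul0r big1 // => l Pl; case: eqP => [e|_]; last by rewrite mul0r.
by move: Pi; rewrite -e Pl.
Qed.

Lemma coroot_sum (K : comPzRingType) (P : pred 'I_n) (r : aroot) (x : 'rV[K]_n) :
  \sum_(l | P l) (coroot r 0 l)%:~R * x 0 l =
  ((P r.1.1)%:R * x 0 r.1.1 + (P (rev_ord r.1.2))%:R * x 0 (rev_ord r.1.2)
   - (P r.1.2)%:R * x 0 r.1.2 - (P (rev_ord r.1.1))%:R * x 0 (rev_ord r.1.1))
  *+ (if (r.1.1 == mid m) || (r.1.2 == mid m) then 2 else 1).
Proof.
rewrite -!sum_delta -big_split -!sumrB -sumrMnl /=.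
apply: eq_bigr => l _; rewrite mxE rmorphMn /= !rmorphB rmorphD /= -!pmulrn.
by case: ifP => _; ring.
Qed.

(** The factor between the Euclidean pairing with the coroot and the linear part of the root, on the
    apartment. Its positivity lets Euclidean distances decide on which side of a hyperplane a point
    lies. *)
Definition coroot_const (K : pzRingType) (r : aroot) : K :=
  if (r.1.1 == mid m) || (r.1.2 == mid m) then 4 else 2.

Lemma coroot_const_gt0 (K : realFieldType) (r : aroot) : 0 < coroot_const K r.
Proof. by rewrite /coroot_const; case: ifP => _; rewrite ltr0n. Qed.

Lemma coroot_pairing (K : comPzRingType) (r : aroot) (x : 'rV[K]_n) : balanced K m x ->
  \sum_l (coroot r 0 l)%:~R * x 0 l = coroot_const K r * (x 0 r.1.1 - x 0 r.1.2).
Proof.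
move=> hx; rewrite (coroot_sum predT) /coroot_const /=.
have -> : x 0 (rev_ord r.1.1) = x 0 (mid m) *+ 2 - x 0 r.1.1 by rewrite -(hx r.1.1); ring.
have -> : x 0 (rev_ord r.1.2) = x 0 (mid m) *+ 2 - x 0 r.1.2 by rewrite -(hx r.1.2); ring.
by case: ifP => _; ring.
Qed.

Lemma root_coroot_intr (K : pzRingType) (r : aroot) : isroot r ->
  (coroot r 0 r.1.1)%:~R - (coroot r 0 r.1.2)%:~R = 2 :> K.
Proof. by move=> /root_coroot h; rewrite -intrB h. Qed.

Lemma refl_trE (r : aroot) l : zaff_tr (refl r) 0 l = r.2 * coroot r 0 l.
Proof. by rewrite mxE. Qed.

Lemma refl_Waff (r : aroot) : isroot r -> Waff (refl r).
Proof.
move=> hr; split; last exact: refl_lin_Sstar.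
split=> [i|i|].
- by rewrite !refl_trE -!mulrDr coroot_balanced coroot_mid !mul0rn mulr0.
- by rewrite !refl_trE coroot_rev; ring.
- have -> : \sum_(i < n | (i < m)%N) zaff_tr (refl r) 0 i
    = r.2 * (\sum_(i < n | (i < m)%N) (coroot r 0 i)%:~R * (const_mx 1 : 'rV[int]_n) 0 i).
    rewrite mulr_sumr; apply: eq_bigr => i _.
    by rewrite refl_trE [(const_mx _) _ _]mxE mulr1 intz.
  rewrite coroot_sum !mxE !mulr1.
  apply: dvdz_mull.
  case: r hr => [[i j] d]; rewrite /isroot /is_root /= !ord_neq /= !val_mid => hr.
  have Hi := ltn_ord i; have Hj := ltn_ord j.
  case: ifPn => [_|ijm]; first by rewrite -mulr_natr; exact: dvdz_mull.
  (* For a long root neither index is [mid], so exactly one of i, i' lies below it, and the sum is 2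
     [i < m] - 2 [j < m]. *)
  have -> : (n - i.+1 < m)%N = ~~ (i < m)%N by lia.
  have -> : (n - j.+1 < m)%N = ~~ (j < m)%N by lia.
  by case: (i < m)%N; case: (j < m)%N.
Qed.

Lemma Waff_Wext (w : zaff n) : Waff w -> Wext w.
Proof. by case=> -[]. Qed.

Lemma refl_Wext (r : aroot) : isroot r -> Wext (refl r).
Proof. by move=> /refl_Waff/Waff_Wext. Qed.

(* The images of the points 0 and [linpt] of the apartment determine the
   translation and the permutation. *)
Lemma zaff_ext (K : realFieldType) (w w' : zaff n) :
  (forall x : 'rV[K]_n, balanced K m x -> zaff_act w x = zaff_act w' x) -> w = w'.
Proof.
case: w w' => [l s] [l' s'] h.
have el : l = l'.
  apply/rowP => i; apply: (@intr_inj K).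
  by have /rowP/(_ i) := h 0 (@balanced0 m K); rewrite !mxE !addr0.
subst l'; congr ZAff; apply: invg_inj; apply/permP => i; apply: linpt_inj.
apply: (@intr_inj K).
have /rowP/(_ i) := h _ (balanced_intr K (@linpt_balanced m)).
by rewrite !mxE => /addrI.
Qed.

Lemma rval_refl (K : realFieldType) (r : aroot) (x : 'rV[K]_n) : isroot r -> balanced K m x ->
  rval r (zaff_act (refl r) x) = - rval r x.
Proof.
move=> hr hx; rewrite refl_act // {1}/rval.
have e l : (x - rval r x *: map_mx intr (coroot r)) 0 l
    = x 0 l - rval r x * (coroot r 0 l)%:~R by rewrite !mxE.
have := root_coroot_intr K hr.
rewrite !e; set a := _%:~R; set b := _%:~R => h.
have -> : x 0 r.1.1 - rval r x * a - (x 0 r.1.2 - rval r x * b) - r.2%:~R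
   = rval r x - rval r x * (a - b) by rewrite /rval; ring.
by rewrite h; ring.
Qed.

Lemma refl_sq (r : aroot) : isroot r -> (refl r * refl r)%g = 1%g.
Proof.
move=> hr; apply: (@zaff_ext rat) => x hx; rewrite zaff_actM.
have hsx := balanced_act (refl_Wext hr) hx.
by rewrite (refl_act hr hsx) rval_refl // refl_act // scaleNr opprK subrK zaff_act1.
Qed.

Lemma refl_inv (r : aroot) : isroot r -> (refl r)^-1%g = refl r.
Proof. by move=> hr; apply/mulg1_eq/refl_sq. Qed.

Lemma coroot_act (w : zaff n) (r : aroot) : Wext w ->
  coroot (root_act w r) = permv (zaff_lin w) (coroot r).
Proof.
case=> _ hs; apply/rowP => l; rewrite !mxE /= -!hs.
have e (a : 'I_n) : (l == zaff_lin w a) = ((zaff_lin w)^-1%g l == a).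
  by rewrite -(inj_eq (@perm_inj _ (zaff_lin w))) permKV.
by rewrite !e -[in LHS](Sstar_mid hs) !(inj_eq perm_inj).
Qed.

Lemma act_sub (K : comPzRingType) (w : zaff n) (x y : 'rV[K]_n) :
  zaff_act w (x - y) = zaff_act w x - permv (zaff_lin w) y.
Proof. by apply/rowP => i; rewrite !mxE addrA. Qed.

Lemma refl_conj (w : zaff n) (r : aroot) : Wext w -> isroot r ->
  refl (root_act w r) = (w * refl r * w^-1)%g.
Proof.
move=> hw hr; apply: (@zaff_ext rat) => x hx; rewrite !zaff_actM.
have hy := balanced_act (WextV hw) hx.
have hr' : isroot (root_act w r) by rewrite isroot_act //; case: hw.
rewrite (refl_act hr' hx) (refl_act hr hy) act_sub -zaff_actM mulgV.
rewrite zaff_act1; congr (_ - _); rewrite rval_actV invgK coroot_act //.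
by apply/rowP => i; rewrite !mxE.
Qed.

End ReflectionGroup.

(** * Simple roots and the base alcove *)

Section SimpleRoots.
Variable m : nat.
Hypothesis m_gt0 : (0 < m)%N.
Local Notation n := m.*2.+1.
Local Notation aroot := ('I_n * 'I_n * int)%type.

(* Positivity at [basept] below, with denominators cleared. *)
Definition pos (r : aroot) : bool :=
  r.2 * (m.*2.+2)%:Z < (r.1.1)%:Z - (r.1.2)%:Z.

(** Equally spaced coordinates with step 1 / (2m + 2): two distinct ones differ by less than 1,
    hence by a non-integer, so no affine root vanishes here. *)
Definition basept (K : fieldType) : 'rV[K]_n :=
  \row_i ((i%:R - m%:R) / (m.*2.+2)%:R).

Lemma basept_balanced (K : realFieldType) : balanced K m (basept K).
Proof.
move=> i; rewrite !mxE val_mid subrr mul0r mul0rn -mulrDl /=.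
have -> : (n - i.+1 = m + m - i)%N by lia.
have im : (i <= m + m)%N by have := ltn_ord i; lia.
rewrite natrB // natrD; set c := _^-1.
by move: (i%:R) (m%:R) => a b; rewrite (_ : a - b + (b + b - a - b) = 0) ?mul0r //; ring.
Qed.

Lemma rval_basept (K : realFieldType) (r : aroot) :
  rval r (basept K) = ((r.1.1)%:Z - (r.1.2)%:Z - r.2 * (m.*2.+2)%:Z)%:~R / (m.*2.+2)%:R.
Proof.
rewrite /rval !mxE !intrB intrM -!pmulrn.
have : (m.*2.+2)%:R != 0 :> K by rewrite pnatr_eq0.
by move: (_%:R) (m%:R) => N b N0; field.
Qed.

Lemma posE (K : realFieldType) (r : aroot) : pos r = (0 < rval r (basept K)).
Proof.
by rewrite rval_basept pmulr_lgt0 ?invr_gt0 ?ltr0n // ltr0z /pos subr_gt0.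
Qed.

Lemma pos_neg (r : aroot) : isroot r -> pos (rneg r) = ~~ pos r.
Proof.
case: r => [[i j] d]; rewrite /isroot /is_root /pos /= ord_neq => hr.
have Hi := ltn_ord i; have Hj := ltn_ord j.
have [/eqP d0|] := boolP (d == 0); first by subst d; lia.
nia.
Qed.

Lemma basept_neq0 (K : realFieldType) (r : aroot) : isroot r -> rval r (basept K) != 0.
Proof.
move=> hr; have := pos_neg hr; rewrite !(posE K) rval_neg.
by case: eqP => // ->; rewrite oppr0 ltxx.
Qed.

(* The walls of the base alcove. *)
Definition sroot (k : 'I_m.+1) : aroot :=
  if k == ord0 then (inord 1, ord_max, -1) else (inord k, inord k.-1, 0).

Lemma sroot_root k : isroot (sroot k).
Proof.
rewrite /sroot /isroot /is_root; case: ifPn => /= k0; rewrite !ord_neq /=.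
  by rewrite inordK; lia.
move: k0; rewrite ord_neq /= => k0; have := ltn_ord k => kl.
by rewrite !inordK; lia.
Qed.

Lemma sroot_pos k : pos (sroot k).
Proof.
rewrite /sroot /pos; case: ifPn => /= k0; first by rewrite inordK; lia.
move: k0; rewrite ord_neq /= => k0; have := ltn_ord k => kl.
by rewrite !inordK; lia.
Qed.

(** * Positive affine roots as nonnegative combinations of the walls *)

Section Cone.
Variable K : realFieldType.
Definition in_cone (g : 'rV[K]_n -> K) : Prop :=
  exists2 c : 'I_m.+1 -> K, forall k, 0 <= c k &
    forall x, balanced K m x -> g x = \sum_k c k * rval (sroot k) x.

Lemma in_cone_ext g g' : (forall x, balanced K m x -> g x = g' x) ->
  in_cone g -> in_cone g'.
Proof. by move=> e [c c0 h]; exists c => // x hx; rewrite -e // h. Qed.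

Lemma in_coneD g g' : in_cone g -> in_cone g' -> in_cone (fun x => g x + g' x).
Proof.
move=> [c c0 h] [c' c0' h']; exists (fun k => c k + c' k) => [k|x hx].
  by rewrite addr_ge0.
by rewrite h // h' // -big_split; apply: eq_bigr => k _; rewrite mulrDl.
Qed.

Lemma in_cone0 : in_cone (fun=> 0).
Proof. by exists (fun=> 0) => // x hx; rewrite big1 // => k _; rewrite mul0r. Qed.

Lemma in_cone_sroot k : in_cone (rval (sroot k)).
Proof.
exists (fun l => (l == k)%:R) => [l|x hx]; first exact: ler0n.
rewrite (bigD1 k) //= eqxx mul1r big1 ?addr0 // => l /negbTE->; exact: mul0r.
Qed.

(** Beyond the middle a gap equals its mirror image, x_(l+1) - x_l = x_k - x_(k-1) with k = 2m - l,
    so the walls 1, ..., m account for all gaps. *)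
Lemma in_cone_step (l : nat) : (l < m.*2)%N ->
  in_cone (fun x => x 0 (inord l.+1) - x 0 (inord l)).
Proof.
move=> lm; have [l_lt|l_ge] := ltnP l m.
  apply: in_cone_ext (in_cone_sroot (inord l.+1)) => x hx.
  by rewrite /rval /sroot ord_neq inordK //= subr0.
apply: in_cone_ext (in_cone_sroot (inord (m.*2 - l))) => x hx.
rewrite /rval /sroot ord_neq inordK /=; last by lia.
rewrite ifN; last by lia.
rewrite /= subr0.
have e (i j : 'I_n) : (i + j = m.*2)%N -> x 0 i = x 0 (mid m) *+ 2 - x 0 j.
  move=> ij; rewrite -(hx j) (_ : rev_ord j = i); first by ring.
  by apply: val_inj => /=; lia.
rewrite (e (inord (m.*2 - l)) (inord l)); last by rewrite !inordK; lia.
rewrite (e (inord (m.*2 - l).-1) (inord l.+1)); last by rewrite !inordK; lia.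
by ring.
Qed.

Lemma in_cone_diff (i j : 'I_n) : (i <= j)%N -> in_cone (fun x => x 0 j - x 0 i).
Proof.
move=> ij; rewrite -[j]inord_val -[i]inord_val.
have := ltn_ord j; move: (nat_of_ord i) (nat_of_ord j) ij => {}i {}j ij jn.
elim: j ij jn => [|j IHj] ij jn.
  have -> : i = 0%N by lia.
  by apply: in_cone_ext in_cone0 => x _; rewrite subrr.
have [->|ij'] := eqVneq i j.+1.
  by apply: in_cone_ext in_cone0 => x _; rewrite subrr.
have j_lt : (j < m.*2)%N by lia.
have h : in_cone (fun x : 'rV[K]_n => x 0 (inord j) - x 0 (inord i)) by apply: IHj; lia.
by apply: in_cone_ext (in_coneD (in_cone_step j_lt) h) => x _; rewrite addrA subrK.
Qed.

(** 1 = (x_1 - x_2m + 1) + (x_2m - x_1). This absorbs the integer parts of roots, and also shows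
    that the walls have no common point. *)
Lemma in_cone1 : in_cone (fun=> 1).
Proof.
apply: in_cone_ext
  (in_coneD (in_cone_sroot ord0) (in_cone_diff (i := inord 1) (j := ord_max) _)).
  by move=> x _; rewrite /rval /sroot eqxx /=; ring.
by rewrite inordK /=; lia.
Qed.

Lemma in_cone_nat k : in_cone (fun=> k%:R).
Proof.
elim: k => [|k IH]; first exact: in_cone0.
by apply: in_cone_ext (in_coneD in_cone1 IH) => x _; rewrite -nat1r.
Qed.

Lemma in_cone_pos r : isroot r -> pos r -> in_cone (rval r).
Proof.
have key (i j : 'I_n) (d : int) : (1 <= i)%N -> isroot (i, j, d) -> pos (i, j, d) ->
    in_cone (rval (i, j, d)).
  rewrite /isroot /is_root /pos /= !ord_neq /= => i1 hij hp.
  have Hi := ltn_ord i; have Hj := ltn_ord j.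
  have [ij|ij] := leqP j i.
    have d0 : d <= 0 by nia.
    apply: in_cone_ext (in_coneD (in_cone_diff ij) (in_cone_nat (absz d))) => x hx.
    by rewrite /rval /= -[d in RHS]opprK -[- d]gez0_abs ?oppr_ge0 // abszN mulrNz opprK pmulrn.
  (* Now x_i - x_j - d is the sum of x_i - x_1, x_2m - x_j, the wall x_1 - x_2m + 1 and the natural
     number -(d + 1). *)
  have d1 : d + 1 <= 0 by nia.
  have := in_coneD (in_cone_diff (i := inord 1) (j := i) _)
    (in_coneD (in_cone_diff (i := j) (j := ord_max) _)
    (in_coneD (in_cone_sroot ord0) (in_cone_nat (absz (d + 1))))).
  rewrite inordK /=; last by lia.
  move=> /(_ _ _); move=> /(_ i1 _); move=> h.
  apply: in_cone_ext (h _); last by lia.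
  move=> x hx; rewrite /rval /sroot eqxx /=.
  have -> : ((absz (d + 1)))%:R = - (d%:~R + 1) :> K.
    by rewrite pmulrn -abszN gez0_abs ?oppr_ge0 // mulrNz intrD.
  by ring.
(* For i = 0 the difference x_i - x_1 has the wrong sign; but (j', i', d) is the same function on
   the apartment, and j' >= 1 since (0, 2m) is no root. *)
case: r => [[i j] d] hr hp.
have [i1|i0] := ltnP 0 i; first exact: key.
have hr' : isroot (rev_ord j, rev_ord i, d).
  move: hr; rewrite /isroot /is_root /= !ord_neq /= => hr.
  by have Hi := ltn_ord i; have Hj := ltn_ord j; lia.
apply: in_cone_ext (key _ _ _ _ hr' _).
- move=> x hx; rewrite /rval /=.
  have -> : x 0 (rev_ord i) = x 0 (mid m) *+ 2 - x 0 i by rewrite -(hx i); ring.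
  have -> : x 0 (rev_ord j) = x 0 (mid m) *+ 2 - x 0 j by rewrite -(hx j); ring.
  by ring.
- move: hr hp; rewrite /isroot /is_root /pos /= !ord_neq /= => hr hp.
  by have Hi := ltn_ord i; have Hj := ltn_ord j; lia.
- move: hp; rewrite /pos /=.
  by have Hi := ltn_ord i; have Hj := ltn_ord j; lia.
Qed.

End Cone.

Definition in_closed_alcove (K : realFieldType) (p : 'rV[K]_n) : Prop :=
  balanced K m p /\ forall k, 0 <= rval (sroot k) p.

Section Alcove.
Variable K : realFieldType.
Implicit Types (p x y : 'rV[K]_n) (r : aroot).

Lemma closed_alcove_pos p r : in_closed_alcove p -> isroot r -> pos r -> 0 <= rval r p.
Proof.
move=> [hp fp] hr pr; have [c c0 ->] // := in_cone_pos K hr pr.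
by apply: sumr_ge0 => k _; rewrite mulr_ge0.
Qed.

Lemma open_alcove_pos p r : balanced K m p -> (forall k, 0 < rval (sroot k) p) ->
  isroot r -> pos r -> 0 < rval r p.
Proof.
move=> hp fp hr pr; have [c c0 h] := in_cone_pos K hr pr.
have F k : 0 <= c k * rval (sroot k) p by rewrite mulr_ge0 // ltW.
rewrite h // lt_def sumr_ge0 // andbT; apply/eqP => /psumr_eq0P s0.
have /negP[] := basept_neq0 K hr; rewrite (h _ (basept_balanced K)).
rewrite big1 // => k _; have /eqP := s0 (fun k _ => F k) k isT.
by rewrite mulf_eq0 (gt_eqF (fp k)) orbF => /eqP->; rewrite mul0r.
Qed.

(** A nonnegative combination of walls that vanishes at [p] involves only walls through [p]. Hence
    facets of the closed alcove are determined by the walls containing them. *)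
Lemma root_vanish p y r : in_closed_alcove p -> balanced K m y ->
  (forall k, rval (sroot k) p = 0 -> rval (sroot k) y = 0) ->
  isroot r -> rval r p = 0 -> rval r y = 0.
Proof.
move=> hp hy py.
have key r' : isroot r' -> pos r' -> rval r' p = 0 -> rval r' y = 0.
  case: hp => hp fp hr pr; have [c c0 h] := in_cone_pos K hr pr.
  have F k : 0 <= c k * rval (sroot k) p by rewrite mulr_ge0.
  rewrite !h // => /psumr_eq0P s0; rewrite big1 // => k _.
  have /eqP := s0 (fun k _ => F k) k isT.
  by rewrite mulf_eq0 => /orP[/eqP->|/eqP/py->]; rewrite ?mul0r ?mulr0.
move=> hr; case: (boolP (pos r)) => [|/negPf np] rp; first exact: key.
have := key (rneg r); rewrite isroot_neg pos_neg // np !rval_neg rp oppr0.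
by move=> /(_ hr isT erefl)/eqP; rewrite oppr_eq0 => /eqP.
Qed.

(** The vertex opposite to wall k, of the form (-c, ..., -c, 0, ..., 0, c, ..., c) with k entries at
    each end. For k >= 2 the equation x_1 - x_2m = -1 of wall 0 forces c = 1/2; for k = 1 it reads
    -c = -1, because x_1 = 0. *)
Definition vertex (k : 'I_m.+1) : 'rV[K]_n :=
  \row_i ((if k == 1 :> nat then 1 else 2^-1)
          * ((m.*2 - k < i)%N%:R - (i < k)%N%:R)).

Lemma vertex_balanced k : balanced K m (vertex k).
Proof.
move=> i; rewrite !mxE val_mid -mulrDr /=.
have Hi := ltn_ord i; have Hk := ltn_ord k.
have -> : (m.*2 - k < n - i.+1)%N = (i < k)%N by lia.
have -> : (n - i.+1 < k)%N = (m.*2 - k < i)%N by lia.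
have -> : (m.*2 - k < m)%N = false by lia.
have -> : (m < k)%N = false by lia.
by rewrite addrA subrK !subrr !mulr0 mul0rn.
Qed.

Lemma vertex_neq j k : j != k -> rval (sroot j) (vertex k) = 0.
Proof.
have Hj := ltn_ord j; have Hk := ltn_ord k.
rewrite /rval /sroot !ord_neq /= => jk; case: ifPn => /= j0; rewrite !mxE /= !inordK; try lia.
  have -> : (m.*2 - k < 1)%N = false by lia.
  have -> : (m.*2 - k < m.*2)%N = true by lia.
  have -> : (m.*2 < k)%N = false by lia.
  case: eqP => k1; first by rewrite k1 /= ?mulrN1z ?mulr0n ?mulr1n; lra.
  by rewrite (_ : (1 < k)%N = true); [rewrite /= ?mulrN1z ?mulr0n ?mulr1n; lra|lia].
have -> : (m.*2 - k < j)%N = false by lia.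
have -> : (m.*2 - k < j.-1)%N = false by lia.
have -> : (j.-1 < k)%N = (j < k)%N by lia.
by rewrite subrr subr0.
Qed.

Lemma vertex_gt0 k : 2^-1 <= rval (sroot k) (vertex k).
Proof.
have Hk := ltn_ord k.
rewrite /rval /sroot !ord_neq /=; case: ifPn => /= k0; rewrite !mxE /= !inordK; try lia.
  move/eqP: k0 => ->; rewrite /= subn0.
  have -> : (m.*2 < 1)%N = false by lia.
  by rewrite ltnn; lra.
have -> : (m.*2 - k < k)%N = false by lia.
have -> : (m.*2 - k < k.-1)%N = false by lia.
have -> : (k.-1 < k)%N by lia.
by rewrite ltnn; case: eqP => _; rewrite /=; lra.
Qed.

(** Each wall takes a smaller value at the base point than at the opposite vertex, so the line
    through the two meets the wall. Wall 0 needs the weaker bound: its value 3 / (2m + 2) is at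
    least 1/2 for m <= 2. *)
Lemma basept_sroot k : rval (sroot k) (basept K) < 2^-1 * (if k == ord0 then 2 else 1).
Proof.
have Hk := ltn_ord k.
rewrite rval_basept ltr_pdivrMr ?ltr0n // /sroot.
case: ifPn => k0 /=; rewrite ?mulr1.
  rewrite inordK; last by lia.
  rewrite (_ : (1%N : int) - (m.*2 : int) - -1 * (m.*2.+2 : int) = 3); last by lia.
  by rewrite mulVf // mul1r -[3%:~R]/(3%:R) ltr_nat; lia.
move: k0; rewrite ord_neq /= => k0.
rewrite !inordK; try lia.
rewrite (_ : (k : int) - (k.-1 : int) - 0 * (m.*2.+2 : int) = 1); last by lia.
rewrite mulrC ltr_pdivlMr // mul1r -[2]/(2%:R) ltr_nat; lia.
Qed.

Lemma vertex0 : rval (sroot ord0) (vertex ord0) = 1.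
Proof.
rewrite /rval /sroot /= !mxE /= inordK; last by lia.
have -> : (m.*2 - 0 < 1)%N = false by lia.
by rewrite subn0 ltnn; lra.
Qed.

Lemma rval_segment r t x y :
  rval r ((1 - t) *: x + t *: y) = (1 - t) * rval r x + t * rval r y.
Proof. by rewrite /rval !mxE; ring. Qed.

Lemma balanced_segment t x y : balanced K m x -> balanced K m y ->
  balanced K m ((1 - t) *: x + t *: y).
Proof. by move=> hx hy; apply: balancedD; apply: balancedZ. Qed.

(* The point where the line from the vertex [k] through the base point meets
   the wall [k]. *)
Lemma wall_point k : exists z, [/\ balanced K m z, rval (sroot k) z = 0
  & forall j, j != k -> 0 < rval (sroot j) z].
Proof.
set a := rval (sroot k) (basept K); set b := rval (sroot k) (vertex k).
have ab : 0 < b - a.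
  rewrite subr_gt0; have := basept_sroot k; rewrite -/a /b.
  case: eqP => [->|_]; first by rewrite vertex0; lra.
  by rewrite mulr1 => h; exact: lt_le_trans (vertex_gt0 k).
have a0 : 0 < a by rewrite /a -posE sroot_pos.
have t0 : 0 < a / (b - a) by rewrite divr_gt0.
exists ((1 - - (a / (b - a))) *: basept K + - (a / (b - a)) *: vertex k); split.
- by apply: balanced_segment; [exact: basept_balanced|exact: vertex_balanced].
- rewrite rval_segment -/a -/b; field; exact: lt0r_neq0.
- move=> j jk; rewrite rval_segment vertex_neq // mulr0 addr0 opprK.
  apply: mulr_gt0; first by rewrite addr_gt0 ?ltr01.
  by rewrite -posE sroot_pos.
Qed.

End Alcove.
End SimpleRoots.

(** * Reflections in the walls of the base alcove *)

Section SimpleReflections.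
Variable m : nat.
Hypothesis m_gt0 : (0 < m)%N.
Local Notation n := m.*2.+1.
Local Notation aroot := ('I_n * 'I_n * int)%type.
Implicit Types (r f : aroot) (w g : zaff n).

Definition srefl (k : 'I_m.+1) : zaff n := refl (sroot k).

(** Different triples may describe the same hyperplane. By [coroot_pairing] the combination [u] of
    the two coroots is orthogonal to the apartment; being itself in the apartment it is 0. The
    remaining scalar is fixed by the value 2 of a root on its coroot. *)
Lemma proportional_refl (K : realFieldType) r f (c : K) : isroot r -> isroot f ->
  (forall x, balanced K m x -> rval r x = c * rval f x) -> refl r = refl f.
Proof.
move=> hr hf h; apply: (@zaff_ext m K) => x hx; rewrite !refl_act //.
pose C r0 : 'rV[K]_n := map_mx intr (coroot r0).
have hC r0 : balanced K m (C r0) by apply/balanced_intr/coroot_balanced.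
pose kap := @coroot_const m K.
have kap_gt0 r0 : 0 < kap r0 by exact: coroot_const_gt0.
have CE0 r0 l : C r0 0 l = (coroot r0 0 l)%:~R by rewrite [LHS]mxE.
have pair r0 (y : 'rV[K]_n) : balanced K m y ->
    \sum_l C r0 0 l * y 0 l = kap r0 * (y 0 r0.1.1 - y 0 r0.1.2).
  by move=> hy; rewrite -coroot_pairing //; apply: eq_bigr => l _; rewrite CE0.
have lin (y : 'rV[K]_n) : balanced K m y ->
    y 0 r.1.1 - y 0 r.1.2 = c * (y 0 f.1.1 - y 0 f.1.2).
  move=> hy; have := h _ hy; have := h _ (@balanced0 m K).
  rewrite /rval !mxE => e0 e1.
  have -> : y 0 r.1.1 - y 0 r.1.2
      = (y 0 r.1.1 - y 0 r.1.2 - r.2%:~R) - (0 - 0 - r.2%:~R) by ring.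
  by rewrite e1 e0; ring.
pose k := c * kap r / kap f.
have CE : C r = k *: C f.
  pose u := kap f *: C r - (c * kap r) *: C f.
  have hu : balanced K m u.
    by apply: balancedD; [exact: balancedZ|apply/balancedN; exact: balancedZ].
  have u2 : \sum_l u 0 l ^+ 2 = 0.
    rewrite (eq_bigr (fun l => kap f * (C r 0 l * u 0 l) - (c * kap r) * (C f 0 l * u 0 l))).
      by rewrite sumrB -!mulr_sumr !pair // lin //; ring.
    by move=> l _; rewrite expr2 {1}/u !mxE; ring.
  have u0 l : u 0 l = 0.
    apply/eqP; rewrite -sqrf_eq0; apply/eqP.
    by apply: (psumr_eq0P _ u2) => // i _; exact: sqr_ge0.
  apply/rowP => l; have := u0 l.
  have -> : u 0 l = kap f * C r 0 l - (c * kap r) * C f 0 l by rewrite !mxE.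
  move=> /eqP; rewrite subr_eq0 => /eqP e; rewrite [RHS]mxE.
  apply: (mulfI (lt0r_neq0 (kap_gt0 f))); rewrite e /k.
  by move: (kap_gt0 f) => /lt0r_neq0; move: (kap f) (kap r) => a b a0; field.
have two r0 : isroot r0 -> C r0 0 r0.1.1 - C r0 0 r0.1.2 = 2.
  by move=> h0; rewrite !CE0 root_coroot_intr.
have ck : c * k = 1.
  have := two r hr; rewrite lin // CE.
  have -> : (k *: C f) 0 f.1.1 - (k *: C f) 0 f.1.2 = k * (C f 0 f.1.1 - C f 0 f.1.2).
    by rewrite [in LHS]mxE [X in _ - X]mxE mulrBr.
  rewrite two // mulrA => e; apply: (@mulIf _ 2); first by rewrite pnatr_eq0.
  by rewrite e mul1r.
congr (_ - _); rewrite -/(C r) -/(C f) CE h // scalerA.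
by rewrite mulrAC ck mul1r.
Qed.

(** At a point of wall k that lies on no other wall, only the k-th term of the expansion of [r] can
    survive. *)
Lemma wall_root (K : realFieldType) k (z : 'rV[K]_n) r : balanced K m z ->
  (forall j, j != k -> 0 < rval (sroot j) z) -> rval (sroot k) z = 0 ->
  isroot r -> pos r -> rval r z = 0 ->
  exists2 c : K, 0 < c & forall x, balanced K m x -> rval r x = c * rval (sroot k) x.
Proof.
move=> hz zj zk hr pr rz; have [c c0 h] := in_cone_pos m_gt0 K hr pr.
have F j : 0 <= c j * rval (sroot j) z.
  by rewrite mulr_ge0 //; have [->|/zj/ltW//] := eqVneq j k; rewrite zk.
have cj j : j != k -> c j = 0.
  move=> jk; move: rz; rewrite h // => /psumr_eq0P s0.
  have /eqP := s0 (fun k _ => F k) j isT.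
  by rewrite mulf_eq0 (gt_eqF (zj _ jk)) orbF => /eqP.
have hE x : balanced K m x -> rval r x = c k * rval (sroot k) x.
  move=> hx; rewrite h // (bigD1 k) //= big1 ?addr0 // => j /cj->.
  by rewrite mul0r.
exists (c k) => //; rewrite lt_def c0 andbT; apply/eqP => ck.
move: pr; rewrite (posE K) hE ?ck ?mul0r ?ltxx //; exact: basept_balanced.
Qed.

(* The wall [k] is the only hyperplane between the base alcove and its mirror
   image: any such hyperplane contains a point interior to that wall. *)
Lemma sroot_only k r : isroot r -> pos r -> ~~ pos (root_act (srefl k) r) ->
  refl r = srefl k /\ forall g, Wext g -> pos (root_act g r) = pos (root_act g (sroot k)).
Proof.
move=> hr pr npr; have [z [hz zk zj]] := wall_point m_gt0 rat k.
have hk := sroot_root m_gt0 k.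
have cz : in_closed_alcove z.
  split=> // j; have [->|/zj/ltW//] := eqVneq j k; by rewrite zk.
have sz : zaff_act (srefl k) z = z by rewrite refl_act // zk scale0r subr0.
have hr' : isroot (root_act (srefl k) r) by rewrite isroot_act //; case: (refl_Wext hk).
have rz : rval r z = 0.
  apply/eqP; rewrite eq_le (closed_alcove_pos m_gt0 cz) // andbT.
  rewrite -(rval_act (srefl k)) sz -oppr_ge0 -rval_neg.
  by rewrite (closed_alcove_pos m_gt0 cz) // ?isroot_neg ?pos_neg.
have [c c0 h] := wall_root hz zj zk hr pr rz.
split; first exact: proportional_refl h.
move=> g hg; rewrite !(posE rat).
have e r0 : rval (root_act g r0) (basept m rat) = rval r0 (zaff_act g^-1%g (basept m rat)).
  by rewrite rval_actV invgK.
rewrite !e h ?pmulr_rgt0 //; apply: balanced_act; first exact: WextV.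
exact: basept_balanced.
Qed.

(* [displ_norm w] is the squared distance from [basept] to its image under [w],
   scaled to be a natural number; left multiplication by a reflection whose
   hyperplane separates the two points decreases it. *)
Definition displ (w : zaff n) (i : 'I_n) : int :=
  (m.*2.+2)%:Z * zaff_tr w 0 i + ((zaff_lin w)^-1%g i)%:Z - i%:Z.
Definition displ_norm (w : zaff n) : nat := absz (\sum_i displ w i ^+ 2).

Lemma displE (w : zaff n) i : (displ w i)%:~R =
  (m.*2.+2)%:R * (zaff_act w (basept m rat) - basept m rat) 0 i :> rat.
Proof.
rewrite !mxE /displ intrB intrD intrM -!pmulrn.
have : (m.*2.+2)%:R != 0 :> rat by rewrite pnatr_eq0.
by move: (_%:R) (m%:R) => N b N0; field.
Qed.

Lemma displ_refl_lt w r : Wext w -> isroot r -> pos r != pos (root_act w^-1%g r) ->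
  (displ_norm (refl r * w)%g < displ_norm w)%N.
Proof.
move=> hw hr pr; rewrite /displ_norm -ltz_nat !gez0_abs ?sumr_ge0 //;
  try by move=> i _; exact: sqr_ge0.
rewrite -(ltr_int rat) !rmorph_sum /=.
set p := basept m rat; set y := zaff_act w p.
have hp : balanced rat m p by exact: basept_balanced.
have hy : balanced rat m y by apply: balanced_act.
have N0 : 0 < (m.*2.+2)%:R ^+ 2 :> rat by rewrite exprn_gt0 // ltr0n.
have E g : \sum_i ((displ g i ^+ 2)%:~R : rat)
    = (m.*2.+2)%:R ^+ 2 * \sum_i ((zaff_act g p - p) 0 i) ^+ 2.
  by rewrite mulr_sumr; apply: eq_bigr => i _; rewrite rmorphXn /= displE exprMn.
rewrite !E ltr_pM2l // zaff_actM -/y refl_act //.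
set c : 'rV[rat]_n := map_mx intr (coroot r).
have hc : balanced rat m c by apply/balanced_intr/coroot_balanced.
set t := rval r y; set u := rval r p.
pose kap := coroot_const rat r.
have kap_gt0 : 0 < kap by exact: coroot_const_gt0.
have ce l : c 0 l = (coroot r 0 l)%:~R by rewrite [LHS]mxE.
have pair (z : 'rV[rat]_n) : balanced rat m z ->
    \sum_l c 0 l * z 0 l = kap * (z 0 r.1.1 - z 0 r.1.2).
  by move=> hz; rewrite -coroot_pairing //; apply: eq_bigr => l _; rewrite ce.
have two : c 0 r.1.1 - c 0 r.1.2 = 2 by rewrite !ce root_coroot_intr.
(* [u] and [t] are the values of the root at the base point and at its image. The reflection changes
   the squared distance by a positive multiple of their product, which is negative when the
   hyperplane separates the points. *)
have -> : \sum_i ((y - t *: c - p) 0 i) ^+ 2 = \sum_i ((y - p) 0 i) ^+ 2 + 2 * kap * (t * u).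
  have e1 : \sum_i c 0 i * (y - p) 0 i = kap * (t - u).
    rewrite pair; last by apply/balancedD/balancedN.
    by rewrite /t /u /rval !mxE; ring.
  have e2 : \sum_i c 0 i * c 0 i = 2 * kap by rewrite pair // two mulrC.
  rewrite (eq_bigr (fun i => ((y - p) 0 i) ^+ 2 - 2 * t * (c 0 i * (y - p) 0 i)
      + t ^+ 2 * (c 0 i * c 0 i))).
    by rewrite big_split sumrB -!mulr_sumr e1 e2 /=; ring.
  move=> i _; rewrite [c]lock !mxE -lock; ring.
rewrite gtrDl pmulr_rlt0 ?mulr_gt0 //.
have t0 : t != 0.
  rewrite /t /y rval_actV basept_neq0 // isroot_act //; case: hw => _; exact: SstarV.
have u0 : u != 0 by rewrite /u basept_neq0.
move: pr; rewrite !(posE rat) -rval_actV -/p -/y -/t -/u.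
case: (ltrgtP 0 u) u0 => // hu _; case: (ltrgtP 0 t) t0 => // ht _ _.
  by rewrite nmulr_rlt0.
by rewrite pmulr_rlt0.
Qed.

(** The hypothesis places the image of the base point under [g^-1] in the open base alcove, where
    every positive root is positive. *)
Lemma pos_of_simple g : Wext g -> (forall k, pos (root_act g (sroot k))) ->
  forall r, isroot r -> pos (root_act g r) = pos r.
Proof.
move=> hg hk; have hg' := WextV hg.
have hx : balanced rat m (zaff_act g^-1%g (basept m rat)).
  by apply: balanced_act => //; exact: basept_balanced.
have fx k : 0 < rval (sroot k) (zaff_act g^-1%g (basept m rat)).
  by rewrite rval_actV invgK -posE.
have key r : isroot r -> pos r -> pos (root_act g r).
  by move=> hr pr; rewrite (posE rat) -[g]invgK -rval_actV (open_alcove_pos m_gt0).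
move=> r hr; case: (boolP (pos r)) => pr; first by rewrite key.
have hr' : isroot (root_act g r) by rewrite isroot_act //; case: hg.
apply/negbTE; rewrite -pos_neg // -root_act_neg key ?isroot_neg // pos_neg //.
Qed.

End SimpleReflections.

(** * The affine Weyl group *)

Section AffineWeylGroup.
Variable m : nat.
Local Notation n := m.*2.+1.
Local Notation aroot := ('I_n * 'I_n * int)%type.
Implicit Types (r f : aroot) (w g : zaff n).

Lemma sum_half (F : 'I_n -> nat) : (forall i, F (rev_ord i) = F i) -> F (mid m) = 0%N ->
  (\sum_i F i = (\sum_(i < n | (i < m)%N) F i).*2)%N.
Proof.
move=> Fr F0; rewrite (bigID (fun i : 'I_n => (i < m)%N)) /= -[RHS]addnn; congr addn.
rewrite (bigD1 (mid m)) ?val_mid ?ltnn //= F0 add0n.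
rewrite (reindex_inj rev_ord_inj) /=; apply: eq_big => [i|i _]; last exact: Fr.
by rewrite rev_ord_eq rev_mid ord_neq val_mid; have Hi := ltn_ord i; lia.
Qed.

(** The sum of half of the coordinates is not visibly stable under [Sstar], which may carry a
    coordinate across the middle. The sum of all absolute values is, and it is twice a number of the
    same parity. *)
Lemma coroot_lattice_evenE (x : 'rV[int]_n) : (forall i, x 0 i + x 0 (rev_ord i) = 0) ->
  (2 %| (\sum_(i < n | (i < m)%N) x 0 i))%Z = (4 %| \sum_i absz (x 0%R i))%N.
Proof.
move=> hx.
have -> : (\sum_i absz (x 0%R i) = (\sum_(i < n | (i < m)%N) absz (x 0%R i)).*2)%N.
  apply: sum_half => [i|]; first by have := hx i; lia.
  by have := hx (mid m); rewrite rev_mid; lia.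
have -> : (2 %| \sum_(i < n | (i < m)%N) x 0 i)%Z
    = (2 %| \sum_(i < n | (i < m)%N) absz (x 0%R i))%N.
  apply: (big_ind2 (fun (a : int) (b : nat) => (2 %| a)%Z = (2 %| b)%N)) => //.
  by move=> a b c d; lia.
have e (k : nat) : (2 %| k)%N = (4 %| k.*2)%N by lia.
exact: e.
Qed.

Lemma Waff1 : Waff (1%g : zaff n).
Proof.
split; last exact: Sstar1.
split; first exact: balanced0.
  by move=> i; rewrite !mxE.
by rewrite big1 // => i _; rewrite mxE.
Qed.

Lemma coroot_lattice_perm (s : 'S_n) (x : 'rV[int]_n) : Sstar s ->
  coroot_lattice x -> coroot_lattice (permv s x).
Proof.
move=> hs [hx hx0 hev].
have hx0' i : permv s x 0 i + permv s x 0 (rev_ord i) = 0.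
  by rewrite !mxE (SstarV hs).
split=> //; first exact: balanced_perm.
move: hev; rewrite !coroot_lattice_evenE // [in X in _ -> X](reindex_inj (@perm_inj _ s)).
by congr (_ %| _)%N; apply: eq_bigr => i _; rewrite mxE permK.
Qed.

Lemma coroot_latticeD (x y : 'rV[int]_n) :
  coroot_lattice x -> coroot_lattice y -> coroot_lattice (x + y).
Proof.
move=> [hx hx0 hev] [hy hy0 hev']; split; first exact: balancedD.
  by move=> i; rewrite !mxE addrACA hx0 hy0 addr0.
rewrite (eq_bigr (fun i => x 0 i + y 0 i)); last by move=> i _; rewrite mxE.
by rewrite big_split rpredD.
Qed.

Lemma coroot_latticeN (x : 'rV[int]_n) : coroot_lattice x -> coroot_lattice (- x).
Proof.
move=> [hx hx0 hev]; split; first exact: balancedN.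
  by move=> i; rewrite !mxE -opprD hx0 oppr0.
rewrite (eq_bigr (fun i => - x 0 i)); last by move=> i _; rewrite mxE.
by rewrite sumrN rpredN.
Qed.

Lemma WaffM w g : Waff w -> Waff g -> Waff (w * g)%g.
Proof.
move=> [hl hs] [hl' hs']; split; last exact: SstarM.
by apply: coroot_latticeD => //; exact: coroot_lattice_perm.
Qed.

Lemma WaffV w : Waff w -> Waff w^-1%g.
Proof.
move=> [hl hs]; split; last exact: SstarV.
by apply/coroot_latticeN/coroot_lattice_perm => //; exact: SstarV.
Qed.

Lemma increasing_perm1 (s : 'S_n) :
  (forall i j : 'I_n, j = i.+1 :> nat -> (s i < s j)%N) -> s = 1%g.
Proof.
have key (t : 'S_n) : (forall i j : 'I_n, (i < j)%N -> (t i < t j)%N) ->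
    forall i : 'I_n, (i <= t i)%N.
  move=> ht [i Hi] /=; elim: i Hi => // i IH Hi.
  apply: leq_ltn_trans (IH (ltnW Hi)) _; exact: ht.
move=> h0; have h (i j : 'I_n) : (i < j)%N -> (s i < s j)%N.
  case: i => i Hi; case: j => j Hj /=; elim: j Hj => // j IH Hj.
  rewrite ltnS leq_eqVlt => /orP[/eqP e|ij].
    by apply: h0; rewrite /= e.
  apply: ltn_trans (IH (ltnW Hj) ij) _; exact: h0.
have hV (i j : 'I_n) : (i < j)%N -> (s^-1%g i < s^-1%g j)%N.
  move=> ij; rewrite ltnNge leq_eqVlt; apply/negP => /orP[/eqP/val_inj|].
    by move=> /perm_inj e; move: ij; rewrite e ltnn.
  by move=> /h; rewrite !permKV ltnNge ltnW.
apply/permP => i; rewrite perm1; apply: val_inj; apply/eqP.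
rewrite eqn_leq key // andbT; have := key _ hV (s i).
by rewrite permK.
Qed.

(** Simple transitivity on alcoves. The image [x] of the base point under [w^-1] lies in the open
    alcove, and its coordinates differ from the integral translation part by less than 1/2. The
    alcove inequalities then pin down the translation, and afterwards the order of the coordinates
    pins down the permutation. *)
Lemma Waff_pos_id w : (0 < m)%N -> Waff w -> (forall k, pos (root_act w (sroot k))) -> w = 1%g.
Proof.
move=> m_gt0 hw hk.
have [v hv vE] : exists2 v, Waff v & v^-1%g = w.
  by exists w^-1%g; [exact: WaffV|rewrite invgK].
pose x : 'rV[rat]_n := zaff_act v (basept m rat).
have hx : balanced rat m x.
  by apply: balanced_act (Waff_Wext hv) (basept_balanced _ _).
have fx k : 0 < rval (sroot k) x by rewrite rval_actV vE -posE.
have root_pos (i j : 'I_n) : (i < j)%N -> (i + j != m.*2)%N -> x 0 i < x 0 j < x 0 i + 1.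
  move=> ij rij; have Hi := ltn_ord i; have Hj := ltn_ord j.
  have h1 : isroot (j, i, 0) by rewrite /isroot /is_root !ord_neq /=; lia.
  have h2 : isroot (i, j, -1) by rewrite /isroot /is_root !ord_neq /=; lia.
  have p1 : pos (j, i, 0) by rewrite /pos /=; lia.
  have p2 : pos (i, j, -1) by rewrite /pos /=; lia.
  have := open_alcove_pos m_gt0 hx fx h1 p1; have := open_alcove_pos m_gt0 hx fx h2 p2.
  by rewrite /rval /= => a1 a2; apply/andP; split; lra.
case: hv => -[_ hl0 hev] hs.
pose la := zaff_tr v; pose s := (zaff_lin v)^-1%g.
pose b i : rat := ((s i)%:R - m%:R) / (m.*2.+2)%:R.
have xE i : x 0 i = (la 0 i)%:~R + b i by rewrite !mxE.
have half i : `|b i| < 2^-1 :> rat.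
  rewrite /b normrM [X in _ * X]gtr0_norm ?invr_gt0 ?ltr0n // ltr_pdivrMr ?ltr0n //.
  have -> : (m.*2.+2)%:R = 2 * (m%:R + 1) :> rat by rewrite -addn2 -mul2n natrD natrM; ring.
  have h : (s i)%:R <= m%:R + m%:R :> rat.
    by rewrite -natrD ler_nat; have := ltn_ord (s i); lia.
  have h0 : 0 <= (s i)%:R :> rat by rewrite ler0n.
  by rewrite ltr_norml; apply/andP; split; lra.
have la_mid : la 0 (mid m) = 0 by have := hl0 (mid m); rewrite rev_mid /la; lia.
have s_mid : s (mid m) = mid m by apply: Sstar_mid; exact: SstarV.
have x_mid : x 0 (mid m) = 0 by rewrite xE la_mid /b s_mid val_mid subrr mul0r addr0.
have x_rev i : x 0 (rev_ord i) = - x 0 i.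
  by apply/eqP; rewrite -addr_eq0 addrC hx x_mid mul0rn.
have la_rev i : la 0 (rev_ord i) = - la 0 i by have := hl0 i; rewrite /la; lia.
have la_pos (i : 'I_n) : (m < i < m.*2)%N -> la 0 i = 0.
  move=> him; have Hi := ltn_ord i.
  have h1 := root_pos (mid m) i; rewrite val_mid x_mid in h1.
  have /andP[xi0 _] : 0 < x 0 i < 0 + 1 by apply: h1; lia.
  have /andP[_ h2] : x 0 (rev_ord i) < x 0 ord_max < x 0 (rev_ord i) + 1.
    by apply: root_pos => /=; lia.
  have /andP[h3 _] : x 0 i < x 0 ord_max < x 0 i + 1 by apply: root_pos => /=; lia.
  rewrite x_rev in h2; have := half i; rewrite ltr_norml => /andP[a1 a2].
  move: xi0 h2 h3; rewrite xE => b1 b2 b3.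
  have c1 : (la 0 i)%:~R < 1%:~R :> rat by rewrite mulr1z; lra.
  have c2 : (-1)%:~R < (la 0 i)%:~R :> rat by rewrite mulrNz mulr1z; lra.
  by move: c1 c2; rewrite !ltr_int; lia.
have la_max : la 0 ord_max = 0.
  have xm0 : 0 < x 0 ord_max.
    by have /andP[] : x 0 (mid m) < x 0 ord_max < x 0 (mid m) + 1;
      [apply: root_pos; rewrite val_mid /=; lia|rewrite x_mid].
  have xm1 : x 0 ord_max < 1.
    have /andP[_ ] : x 0 (mid m) < x 0 ord_max < x 0 (mid m) + 1;
      [apply: root_pos; rewrite val_mid /=; lia|by rewrite x_mid add0r].
  have := half ord_max; rewrite ltr_norml => /andP[a1 a2].
  move: xm0 xm1; rewrite xE => b1 b2.
  have c1 : (la 0 ord_max)%:~R < 2%:~R :> rat by lra.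
  have c2 : (-1)%:~R < (la 0 ord_max)%:~R :> rat by rewrite mulrNz mulr1z; lra.
  (* The inequalities leave 0 and 1 for the last coordinate; evenness of the coroot lattice excludes
     1. This is the point that separates [Waff] from [Wext]. *)
  have la0 : la 0 ord0 = - la 0 ord_max.
    by rewrite -la_rev; congr (la 0 _); apply: val_inj => /=; lia.
  move: hev; rewrite (bigD1 ord0) //= big1 => [|i /andP[im i0]].
    by move: c1 c2; rewrite -/la la0 !ltr_int addr0; lia.
  have Hi := ltn_ord i; rewrite ord_neq /= in i0.
  have := la_pos (rev_ord i); rewrite la_rev -/la /= => h.
  have h2 : - la 0 i = 0 by apply: h; lia.
  by rewrite -/la; lia.
have la0 i : la 0 i = 0.
  have key (j : 'I_n) : (m < j)%N -> la 0 j = 0.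
    move=> mj; have Hj := ltn_ord j; have [e|jm] := eqVneq (j : nat) m.*2.
      by rewrite -la_max; congr (la 0 _); apply: val_inj => /=.
    by apply: la_pos; lia.
  have Hi := ltn_ord i; case: (ltngtP i m) => [im|/key//|im].
    have := key (rev_ord i); rewrite la_rev /= => h.
    by have : - la 0 i = 0; [apply: h; lia|lia].
  by rewrite -la_mid; congr (la 0 _); apply: val_inj; rewrite /= val_mid.
have s1 : s = 1%g.
  apply: increasing_perm1 => i j ij.
  have : x 0 i < x 0 j by have /andP[] : x 0 i < x 0 j < x 0 i + 1 by apply: root_pos; lia.
  by rewrite !xE !la0 !add0r /b ltr_pM2r ?invr_gt0 ?ltr0n // ltrD2r ltr_nat.
suff v1 : v = 1%g by rewrite -vE v1 invg1.
have hv1 : zaff_lin v = 1%g by rewrite -[zaff_lin v]invgK -/s s1 invg1.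
have hv0 : zaff_tr v = 0 by apply/rowP => i; rewrite [LHS]la0 mxE.
by move: hv0 hv1; case: (v) => l t /= -> ->.
Qed.

End AffineWeylGroup.

(** * Bruhat order *)

Section Order.
Variable m : nat.
Hypothesis m_gt0 : (0 < m)%N.
Local Notation n := m.*2.+1.
Local Notation aroot := ('I_n * 'I_n * int)%type.
Local Notation zn := (zaff n).
Local Open Scope group_scope.
Implicit Types (r f : aroot) (w g x y : zn) (o : aroot -> bool).

(* [pos (x^-1 r)] is the side of the hyperplane of [r] containing the alcove
   [x A], and [o r] is the side that counts as the lower one.  The Bruhat order is
   the case [o = pos], where the lower side is that of the base alcove [A]. *)
Definition ostep o x y :=
  exists r, [/\ isroot r, o r = pos (root_act x^-1 r) & y = refl r * x].
Definition ole o : zn -> zn -> Prop := clos_refl_trans zn (ostep o).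

Lemma ole_refl o x : ole o x x. Proof. exact: rt_refl. Qed.
Lemma ole_trans o y x z : ole o x y -> ole o y z -> ole o x z.
Proof. exact: rt_trans. Qed.
Hint Resolve ole_refl : core.

Lemma ostep_Wext o x y : Wext x -> ostep o x y -> Wext y.
Proof. by move=> hx [r [hr _ ->]]; apply: WextM => //; exact: refl_Wext. Qed.

Lemma ole_Wext o x y : ole o x y -> Wext x -> Wext y.
Proof. by elim=> {x y} [x y h hx|//|x y z _ h1 _ h2 /h1/h2//]; exact: ostep_Wext h. Qed.

Lemma isroot_Wext g r : Wext g -> isroot (root_act g r) = isroot r.
Proof. by case=> _; exact: isroot_act. Qed.

Lemma ole_mull o g x y : Wext g -> ole o x y ->
  ole (fun r => o (root_act g^-1 r)) (g * x) (g * y).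
Proof.
move=> hg; elim=> {x y} [x y [r [hr or ->]]|//|x y z _ h1 _ h2]; last exact: ole_trans h2.
apply: rt_step; exists (root_act g r); split.
- by rewrite isroot_Wext.
- by rewrite root_actK or invMg root_actM root_actK.
- by rewrite refl_conj // !mulgA mulgVK.
Qed.

Lemma eq_ole o o' x y : (forall r, isroot r -> o r = o' r) -> ole o x y -> ole o' x y.
Proof.
move=> e; elim=> {x y} [x y [r [hr or ->]]|//|x y z _ h1 _ h2]; last exact: ole_trans h2.
by apply: rt_step; exists r; split=> //; rewrite -e.
Qed.

Lemma refl_neg r : isroot r -> refl (rneg r) = refl r.
Proof.
move=> hr; apply: (@proportional_refl _ rat _ _ (-1)%R) => //; first by rewrite isroot_neg.
by move=> x _; rewrite rval_neg mulN1r.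
Qed.

Lemma pos_act_neg g r : Wext g -> isroot r -> pos (root_act g (rneg r)) = ~~ pos (root_act g r).
Proof. by move=> hg hr; rewrite root_act_neg pos_neg // isroot_Wext. Qed.

Lemma pos_refl g r : Wext g -> isroot r ->
  pos (root_act g (root_act (refl r) r)) = ~~ pos (root_act g r).
Proof.
move=> hg hr; rewrite -pos_act_neg // !(posE rat) -[root_act g (root_act _ _)]root_actM.
have hb := basept_balanced m_gt0 rat.
have e g0 r0 : rval (root_act g0 r0) (basept m rat) = rval r0 (zaff_act g0^-1 (basept m rat)).
  by rewrite rval_actV invgK.
rewrite !e invMg zaff_actM refl_inv // rval_refl ?rval_neg //.
by apply: balanced_act => //; exact: WextV.
Qed.

Lemma ostep_pos x y : ostep (@pos m) x y -> Wext x ->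
  exists r, [/\ isroot r, pos r, pos (root_act x^-1 r) & y = refl r * x].
Proof.
case=> r [hr e ->] hx; case: (boolP (pos r)) => pr.
  by exists r; split=> //; rewrite -e.
exists (rneg r); split; rewrite ?isroot_neg ?pos_neg ?refl_neg //.
by rewrite pos_act_neg ?e // ?(WextV hx) -?e //; exact: WextV.
Qed.

Lemma ole_Omega_mulr o g x y : Wext g -> (forall r, isroot r -> pos (root_act g r) = pos r) ->
  Wext x -> ole o x y -> ole o (x * g) (y * g).
Proof.
move=> hg pg hx h; move: h hx.
elim=> {x y} [x y [r [hr or ->]] hx|//|x y z h0 h1 _ h2 hx]; last first.
  by apply: ole_trans (h1 hx) (h2 _); exact: ole_Wext h0 hx.
apply: rt_step; exists r; split; rewrite ?mulgA //.
rewrite or invMg root_actM -[in LHS](root_actVK g (root_act x^-1 r)) pg //.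
by rewrite !isroot_Wext //; exact: WextV.
Qed.

(** A step in [r] from [x] becomes one in [x^-1 r] from [x^-1], and for [o = pos] the condition on
    signs is symmetric in these two roots. *)
Lemma ole_inv x y : Wext x -> ole (@pos m) x y -> ole (@pos m) x^-1 y^-1.
Proof.
move=> hx h; move: h hx.
elim=> {x y} [x y [r [hr or ->]] hx|//|x y z h0 h1 _ h2 hx]; last first.
  by apply: ole_trans (h1 hx) (h2 _); exact: ole_Wext h0 hx.
have hx' := WextV hx; apply: rt_step; exists (root_act x^-1 r); split.
- by rewrite isroot_Wext.
- by rewrite invgK root_actVK.
- by rewrite refl_conj // invMg refl_inv // invgK mulgK.
Qed.

Notation s := (@srefl m).
Notation f := (@sroot m).
Notation "x <=B y" := (ole (@pos m) x y) (at level 70).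

Lemma srefl_Waff k : Waff (s k).
Proof. exact/refl_Waff/sroot_root. Qed.
Lemma srefl_Wext k : Wext (s k).
Proof. exact/Waff_Wext/srefl_Waff. Qed.
Lemma srefl_sq k : s k * s k = 1.
Proof. exact/refl_sq/sroot_root. Qed.
Lemma srefl_mulK k : involutive (mulg (s k)).
Proof. by move=> x; rewrite mulgA srefl_sq mul1g. Qed.
Lemma srefl_inv k : (s k)^-1 = s k.
Proof. exact/refl_inv/sroot_root. Qed.

Lemma root_act_srefl x k : Wext x ->
  pos (root_act (s k * x)^-1 (f k)) = ~~ pos (root_act x^-1 (f k)).
Proof.
move=> hx; rewrite invMg srefl_inv root_actM pos_refl //; last exact: sroot_root.
exact: WextV.
Qed.

Lemma srefl_up x k : pos (root_act x^-1 (f k)) -> x <=B s k * x.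
Proof.
move=> px; apply: rt_step; exists (f k).
by rewrite px sroot_pos // sroot_root.
Qed.

Lemma srefl_down x k : Wext x -> ~~ pos (root_act x^-1 (f k)) -> s k * x <=B x.
Proof.
move=> hx px; rewrite -{2}[x](srefl_mulK k); apply: srefl_up.
by rewrite root_act_srefl.
Qed.

Lemma srefl_displ x k : Wext x -> ~~ pos (root_act x^-1 (f k)) ->
  (displ_norm (s k * x)%g < displ_norm x)%N.
Proof.
move=> hx px; apply: displ_refl_lt => //; first exact: sroot_root.
by rewrite sroot_pos // (negbTE px).
Qed.

Definition lmin k x := if pos (root_act x^-1 (f k)) then x else s k * x.
Definition lmax k x := if pos (root_act x^-1 (f k)) then s k * x else x.

Lemma lmin_le_srefl k x : Wext x -> lmin k x <=B s k * x.
Proof. by move=> hx; rewrite /lmin; case: ifPn => // px; exact: srefl_up. Qed.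

(** The reflection in wall k keeps every positive root positive except those proportional to that
    wall ([sroot_only]), so conjugation by it preserves upward steps unless the step is this
    reflection itself. *)
Lemma srefl_step k x y : Wext x -> ostep (@pos m) x y ->
  y = s k * x \/ s k * x <=B s k * y.
Proof.
move=> hx /ostep_pos /(_ hx)[r [hr pr px ->]].
case: (boolP (pos (root_act (s k) r))) => psr; last first.
  by left; have [-> _] := sroot_only m_gt0 hr pr psr.
right; apply: rt_step; exists (root_act (s k) r); split.
- by rewrite isroot_Wext //; exact: srefl_Wext.
- by rewrite psr invMg root_actM root_actK px.
- rewrite refl_conj //; last exact: srefl_Wext.
  by rewrite !mulgA mulgVK.
Qed.

(** The lifting property of the Bruhat order, for a single step. *)
Lemma lift_step k x y : Wext x -> ostep (@pos m) x y ->
  lmin k x <=B lmin k y /\ lmax k x <=B lmax k y.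
Proof.
move=> hx h; have hy := ostep_Wext hx h.
have [->|h2] := srefl_step k hx h.
  rewrite /lmin /lmax root_act_srefl //; case: ifPn => px /=; rewrite ?srefl_mulK; split=> //.
have h1 : x <=B y by exact: rt_step.
rewrite /lmin /lmax; case: ifPn => px; case: ifPn => py; split=> //.
- exact: ole_trans (srefl_up px) h2.
- by apply: ole_trans h2 _; exact: srefl_down.
- by apply: ole_trans h1; exact: srefl_down.
- exact: ole_trans h1 (srefl_up py).
Qed.

Lemma lmin_lmax_mono k x y : Wext x -> x <=B y ->
  lmin k x <=B lmin k y /\ lmax k x <=B lmax k y.
Proof.
move=> hx h; elim: h hx => {x y} [x y h hx|//|x y z h0 h1 _ h2 hx].
  exact: lift_step.
have [a1 a2] := h1 hx; have [b1 b2] := h2 (ole_Wext h0 hx).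
by split; [exact: ole_trans b1|exact: ole_trans b2].
Qed.

Lemma lmin_mono k x y : Wext x -> x <=B y -> lmin k x <=B lmin k y.
Proof. by move=> hx /lmin_lmax_mono-/(_ k hx)[]. Qed.
Lemma lmax_mono k x y : Wext x -> x <=B y -> lmax k x <=B lmax k y.
Proof. by move=> hx /lmin_lmax_mono-/(_ k hx)[]. Qed.

Lemma lower_left k x y : Wext x -> x <=B y ->
  x <=B s k * y \/ s k * x <=B s k * y.
Proof.
move=> hx h; have hy := ole_Wext h hx.
have := ole_trans (lmin_mono k hx h) (lmin_le_srefl k hy).
by rewrite /lmin; case: ifP => _; [left|right].
Qed.

Definition word (l : seq 'I_m.+1) : zn := \prod_(k <- l) s k.

Lemma word_cons k l : word (k :: l) = s k * word l.
Proof. by rewrite /word big_cons. Qed.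

Lemma word_Waff l : Waff (word l).
Proof.
elim: l => [|k l IH]; first by rewrite /word big_nil; exact: Waff1.
by rewrite word_cons; apply: WaffM => //; exact: srefl_Waff.
Qed.

(** The second alternative is length zero: [g] preserves the base alcove. It is the base case of the
    inductions on [displ_norm], the first alternative being the inductive step. *)
Lemma simple_descent g : Wext g ->
  (exists k, ~~ pos (root_act g^-1 (f k))) \/
  (forall r, isroot r -> pos (root_act g r) = pos r).
Proof.
move=> hg; have [h|h] := EM (forall k, pos (root_act g^-1 (f k))); last first.
  have [h'|h'] := EM (exists k, ~~ pos (root_act g^-1 (f k))); first by left.
  by exfalso; apply: h => k; apply/negPn/negP => pk; apply: h'; exists k.
right=> r hr; rewrite -(pos_of_simple m_gt0 (WextV hg) h) ?root_actK // isroot_Wext //.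
Qed.

(** * Fixers of points of the closed alcove *)

Section Parabolic.
Variable K : realFieldType.
Implicit Types p : 'rV[K]_n.

Definition fixer p w := Waff w /\ zaff_act w p = p.

Lemma fixerM p w g : fixer p w -> fixer p g -> fixer p (w * g).
Proof.
by move=> [hw wp] [hg gp]; split; [exact: WaffM|rewrite zaff_actM gp wp].
Qed.
Lemma fixerV p w : fixer p w -> fixer p w^-1.
Proof.
move=> [hw wp]; split; first exact: WaffV.
by rewrite -[in LHS]wp -zaff_actM mulVg zaff_act1.
Qed.
Lemma fixer1 p : fixer p 1.
Proof. by split; [exact: Waff1|rewrite zaff_act1]. Qed.

Lemma srefl_fixer p k : balanced K m p -> rval (f k) p = 0%R -> fixer p (s k).
Proof.
move=> hp fp; split; first exact: srefl_Waff.
by rewrite refl_act ?fp ?scale0r ?subr0 //; exact: sroot_root.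
Qed.

Lemma fundamental_domain p w : in_closed_alcove p -> in_closed_alcove (zaff_act w p) ->
  Waff w -> zaff_act w p = p /\
  exists2 l, (forall k, k \in l -> rval (f k) p = 0%R) & w = word l.
Proof.
move=> hp; have [N] := ubnP (displ_norm w); elim: N w => // N IH w Nw hwp hw.
have Ww := Waff_Wext hw.
have [[k hk]|pw] := simple_descent Ww; last first.
  rewrite (Waff_pos_id m_gt0 hw) ?zaff_act1; last first.
    by move=> k; rewrite pw ?sroot_pos // sroot_root.
  by split=> //; exists [::]; rewrite /word ?big_nil.
have hf := sroot_root m_gt0 k; have hf' : isroot (root_act w^-1 (f k)).
  by rewrite isroot_Wext //; exact: WextV.
(* Wall k separates the base alcove from its image under [w], while [w p] lies in both closures;
   hence [w p] is on wall k and the descent does not move it. *)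
have fk0 : rval (f k) (zaff_act w p) = 0%R.
  apply/eqP; rewrite eq_le; case: hwp => _ ->; rewrite andbT rval_actV -oppr_ge0 -rval_neg.
  by rewrite (closed_alcove_pos m_gt0 hp) ?isroot_neg // pos_neg.
have sw : zaff_act (s k * w) p = zaff_act w p.
  rewrite zaff_actM; case: hwp => hwp _.
  by case: (srefl_fixer hwp fk0).
have Nsw := leq_trans (srefl_displ Ww hk) Nw.
have [|swp [l hl sl]] := IH (s k * w) Nsw _ (WaffM (srefl_Waff k) hw).
  by rewrite sw.
rewrite sw in swp; split=> //; exists (k :: l).
  by move=> j; rewrite inE => /predU1P[->|/hl//]; rewrite -swp.
by rewrite word_cons -sl srefl_mulK.
Qed.

Lemma fixer_word p w : in_closed_alcove p -> fixer p w ->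
  exists2 l, (forall k, k \in l -> rval (f k) p = 0%R) & w = word l.
Proof.
by move=> hp [hw wp]; have [|_ h] := fundamental_domain hp _ hw; rewrite ?wp.
Qed.

Lemma fixer_srefl_ind p (P : zn -> Prop) : in_closed_alcove p ->
  P 1 -> (forall k w, rval (f k) p = 0%R -> fixer p w -> P w -> P (s k * w)) ->
  forall w, fixer p w -> P w.
Proof.
move=> hp P1 PS w /(fixer_word hp)[l hl ->]; have hb := hp.1.
suff [] : P (word l) /\ fixer p (word l) by [].
elim: l hl => [|k l IH] hl.
  by rewrite /word big_nil; split=> //; exact: fixer1.
have [Pl fl] : P (word l) /\ fixer p (word l).
  by apply: IH => j jl; apply: hl; rewrite inE jl orbT.
have fk : rval (f k) p = 0%R by apply: hl; rewrite inE eqxx.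
by rewrite word_cons; split; [exact: PS|apply: fixerM => //; exact: srefl_fixer].
Qed.

Lemma fixer_Wext p w : fixer p w -> Wext w. Proof. by case=> /Waff_Wext. Qed.

(** A comparison descends to cosets of the fixer: [w] is built from wall reflections one at a time,
    and after each of them the lower element either follows or stays ([lower_left]). *)
Lemma project_left p w x y : in_closed_alcove p -> Wext x -> fixer p w -> x <=B y ->
  exists2 w', fixer p w' & w' * x <=B w * y.
Proof.
move=> hp hx hw xy; move: w hw; apply: (fixer_srefl_ind hp) => [|k w fk hw [w' hw' h]].
  by exists 1; [exact: fixer1|rewrite !mul1g].
have [h1|h1] := lower_left k (WextM (fixer_Wext hw') hx) h; rewrite !mulgA in h1.
  by exists w'.
by exists (s k * w'); first by apply: fixerM => //; apply: srefl_fixer => //; exact: hp.1.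
Qed.

Lemma project_right p w x y : in_closed_alcove p -> Wext x -> fixer p w -> x <=B y ->
  exists2 w', fixer p w' & x * w' <=B y * w.
Proof.
move=> hp hx hw /(ole_inv hx) xy; have hx' := WextV hx.
have [w' hw' h] := project_left hp hx' (fixerV hw) xy.
exists w'^-1; first exact: fixerV.
by have := ole_inv (WextM (fixer_Wext hw') hx') h; rewrite !invMg !invgK.
Qed.

End Parabolic.
End Order.

Section Bruhat.
Variable m : nat.
Hypothesis m_gt0 : (0 < m)%N.
Local Notation n := m.*2.+1.
Local Notation aroot := ('I_n * 'I_n * int)%type.
Local Notation zn := (zaff n).
Local Notation s := (@srefl m).
Local Notation f := (@sroot m).
Local Notation "x <=B y" := (ole (@pos m) x y) (at level 70).
Local Open Scope group_scope.
Implicit Types (r : aroot) (w g x y d : zn).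
Hint Resolve ole_refl : core.

(** No step ends at such a [y]: its root [r] would have a sign different from that of [y^-1 r]. *)
Lemma ole_Omega x y : Wext x -> (forall r, isroot r -> pos (root_act y r) = pos r) ->
  x <=B y -> x = y.
Proof.
move=> hx hy h; elim: h hx hy => {x y} [x y [r [hr e ->]] hx hy|//|x y z h0 h1 _ h2 hx hz].
  have hs : isroot (root_act (refl r * x)^-1 r).
    by rewrite isroot_Wext //; apply/WextV/WextM => //; exact: refl_Wext.
  have := hy _ hs; rewrite root_actVK invMg root_actM refl_inv //.
  by rewrite pos_refl ?e //; [case: pos|exact: WextV].
have hy := ole_Wext h0 hx; have yz := h2 hy hz.
by rewrite -yz in hz *; exact: h1.
Qed.

Lemma displ_norm_inv w : displ_norm w^-1 = displ_norm w.
Proof.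
rewrite /displ_norm (reindex_inj (@perm_inj _ (zaff_lin w)^-1)) /=.
congr absz; apply: eq_bigr => i _.
rewrite /displ /= invgK !mxE invgK !permKV -sqrrN; congr (_ ^+ 2)%R; ring.
Qed.

Lemma srefl_displ_right x k : Wext x -> ~~ pos (root_act x (f k)) ->
  (displ_norm (x * s k)%g < displ_norm x)%N.
Proof.
move=> hx px; rewrite -displ_norm_inv -[displ_norm x]displ_norm_inv invMg srefl_inv //.
by apply: srefl_displ; rewrite ?invgK //; exact: WextV.
Qed.

Lemma srefl_down_right x k : Wext x -> ~~ pos (root_act x (f k)) -> x * s k <=B x.
Proof.
move=> hx px; have hx' := WextV hx.
have h : s k * x^-1 <=B x^-1 by apply: srefl_down; rewrite ?invgK.
have := ole_inv (WextM (srefl_Wext m_gt0 k) hx') h.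
by rewrite invMg srefl_inv // invgK.
Qed.

Section Facets.
Variable K : realFieldType.
Implicit Types p : 'rV[K]_n.

Lemma vertex_closed (k : 'I_m.+1) : in_closed_alcove (vertex K k).
Proof.
split; first exact: vertex_balanced.
move=> j; have [->|jk] := eqVneq j k; last by rewrite vertex_neq.
by apply: le_trans (vertex_gt0 m_gt0 K k); rewrite invr_ge0 ler0n.
Qed.

Lemma exists_sroot_gt0 p : in_closed_alcove p -> exists k, (0 < rval (f k) p)%R.
Proof.
move=> [hp fp]; apply: contrapT => h.
have [c _ e] := in_cone1 m_gt0 K; have := e _ hp; rewrite big1 => [/eqP|k _].
  by rewrite oner_eq0.
have /eqP -> : (rval (f k) p == 0)%R; last by rewrite mulr0.
by rewrite eq_le fp andbT leNgt; apply/negP => fk; apply: h; exists k.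
Qed.

Definition right_minimal p x := forall k, rval (f k) p = 0%R -> pos (root_act x (f k)).

(** If wall k made the positive root [x (f j)] negative, the two would be proportional, and
    [x^-1 (f k)] would be positive like [f j]. *)
Lemma right_minimal_srefl p x k : Wext x -> right_minimal p x ->
  ~~ pos (root_act x^-1 (f k)) -> right_minimal p (s k * x).
Proof.
move=> hx px pk j fj; apply: contraNT pk; rewrite root_actM => psx.
have hxj : isroot (root_act x (f j)) by rewrite isroot_Wext ?sroot_root.
have [_ e] := sroot_only m_gt0 hxj (px j fj) psx.
by rewrite -e ?root_actK ?sroot_pos //; exact: WextV.
Qed.

(* Deodhar's criterion: the Bruhat order on cosets of the fixer of a facet is
   detected on the cosets of the fixers of its vertices. *)
Lemma deodhar p x y : in_closed_alcove p -> right_minimal p x -> Wext x -> Wext y ->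
  (forall k, (0 < rval (f k) p)%R -> exists2 u, fixer (vertex K k) u & x * u <=B y) ->
  x <=B y.
Proof.
move=> hp; have [N] := ubnP (displ_norm y); elim: N x y => // N IH x y Ny xmin hx hy h.
have [[k hk]|py] := simple_descent m_gt0 hy; last first.
  (* Here [y] has length zero, so each comparison is an equality and [y^-1 x] fixes all vertices of
     the facet. A wall that it makes negative contains all these vertices, hence [p], against the
     minimality of [x]. *)
  have hu k : (0 < rval (f k) p)%R -> fixer (vertex K k) (y^-1 * x).
    move=> /h[u hu xuy]; rewrite -(ole_Omega _ py xuy).
      by rewrite invMg mulgVK; exact: fixerV.
    by apply: WextM => //; exact: fixer_Wext hu.
  have [k0 /hu[g_Waff _]] := exists_sroot_gt0 hp.
  have -> : x = y; last by [].
  apply: (mulgI y^-1); rewrite mulVg; apply: (Waff_pos_id m_gt0 g_Waff) => k.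
  apply: contraT => npg; set g := y^-1 * x in g_Waff hu npg *.
  have hf := sroot_root m_gt0 k; have hg := Waff_Wext g_Waff.
  have hgf : isroot (root_act g (f k)) by rewrite isroot_Wext.
  have fv j : (0 < rval (f j) p)%R -> rval (f k) (vertex K j) = 0%R.
    move=> /hu[_ gv]; apply/eqP; rewrite eq_le; have [_ ->] := vertex_closed j.
    rewrite andbT -(rval_act g) gv -oppr_ge0 -rval_neg.
    rewrite (closed_alcove_pos m_gt0 (vertex_closed j)) ?isroot_neg //.
    by rewrite pos_neg.
  have fk : rval (f k) p = 0%R.
    apply/eqP; rewrite eq_le; case: hp => _ ->; rewrite andbT leNgt; apply/negP => /fv e.
    by have := vertex_gt0 m_gt0 K k; rewrite e leNgt invr_gt0 ltr0n.
  by have := xmin _ fk; rewrite -[x](mulVKg y) -/g root_actM py // (negbTE npg).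
have Ny' := leq_trans (srefl_displ m_gt0 hy hk) Ny.
have hs := srefl_Wext m_gt0 k; have hy' := WextM hs hy.
have lmy : lmin k y = s k * y by rewrite /lmin (negbTE hk).
have sy : s k * y <=B y by exact: srefl_down.
have down u z : fixer (vertex K z) u -> x * u <=B y ->
    x * u <=B s k * y \/ s k * x * u <=B s k * y.
  move=> hu xuy; have hxu := WextM hx (fixer_Wext hu).
  have := lmin_mono m_gt0 k hxu xuy; rewrite lmy /lmin.
  by case: ifP => _; rewrite ?mulgA; [left|right].
(* If k is no descent of [x], only [y] is lowered; otherwise both are lowered and the result is
   lifted by [lmax_mono]. When [down] returns the other alternative, [project_right] repairs it at
   the cost of a new element of the vertex fixer. *)
case: (boolP (pos (root_act x^-1 (f k)))) => px.
  apply: ole_trans sy; apply: IH => // j /h[u hu /(down _ _ hu)[]]; first by exists u.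
  have [u' hu' xu'] := project_right m_gt0 (vertex_closed j) hx hu (srefl_up m_gt0 px).
  by move=> sxu; exists u' => //; exact: ole_trans xu' sxu.
have hsx := WextM hs hx.
have sxy : s k * x <=B s k * y.
  apply: IH => //; first exact: right_minimal_srefl.
  move=> j /h[u hu /(down _ _ hu)[xu|]]; last by exists u.
  have [u' hu' xu'] := project_right m_gt0 (vertex_closed j) hsx hu (srefl_down m_gt0 hx px).
  by exists u' => //; exact: ole_trans xu' xu.
have := lmax_mono m_gt0 k hsx sxy.
by rewrite /lmax !root_act_srefl // px hk !srefl_mulK.
Qed.

End Facets.

(* If no hyperplane separates both [x] and [g^-1] from the base alcove, the
   lengths of [g] and [x] add up in [g * x]. *)
Lemma cancel_left g x y : Wext g -> Wext x -> Wext y ->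
  (forall r, isroot r -> pos r -> ~~ pos (root_act x^-1 r) -> pos (root_act g r)) ->
  g * x <=B g * y -> x <=B y.
Proof.
move=> hg hx hy; have [N] := ubnP (displ_norm g); elim: N g hg => // N IH g hg Ng H h.
have [[k hk]|pg] := simple_descent m_gt0 hg; last first.
  have := ole_mull (WextV hg) h; rewrite !mulKg; apply: eq_ole => r hr.
  by rewrite invgK pg.
have hs := srefl_Wext m_gt0 k; have hsg := WextM hs hg.
have hf := sroot_root m_gt0 k; have hg' := WextV hg.
apply: (IH (s k * g)) => //.
- exact: leq_trans (srefl_displ m_gt0 hg hk) Ng.
- move=> r hr pr px; rewrite root_actM; apply: contraT => npr.
  have hgr : isroot (root_act g r) by rewrite isroot_Wext.
  have [_ e] := sroot_only m_gt0 hgr (H r hr pr px) npr.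
  by move: hk; rewrite -e // root_actK pr.
(* A descent of [g] is one of [g x]: otherwise the positive root [- g^-1 (f k)] would be made
   negative by both [x^-1] and [g], against [H]. *)
have pgx : ~~ pos (root_act (g * x)^-1 (f k)).
  rewrite invMg root_actM; apply: contraL isT => pxk.
  have hr : isroot (rneg (root_act g^-1 (f k))) by rewrite isroot_neg isroot_Wext.
  have pr : pos (rneg (root_act g^-1 (f k))) by rewrite pos_neg ?isroot_Wext.
  have npg : ~~ pos (root_act g (rneg (root_act g^-1 (f k)))).
    by rewrite root_act_neg root_actVK pos_neg // sroot_pos.
  have := H _ hr pr; rewrite (negbTE npg) pos_act_neg ?isroot_Wext ?pxk //.
    by move=> /(_ isT).
  exact: WextV.
have := lmin_mono m_gt0 k (WextM hg hx) h.
rewrite {1}/lmin (negbTE pgx) -!mulgA => h1; apply: ole_trans h1 _.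
exact: (lmin_le_srefl m_gt0 k (WextM hg hy)).
Qed.

Definition left_minimal (K : realFieldType) (p : 'rV[K]_n) x :=
  forall k, rval (f k) p = 0%R -> pos (root_act x^-1 (f k)).

Section DoubleCosets.
Variable K : realFieldType.
Implicit Types p : 'rV[K]_n.

Lemma left_minimal_le p d x a : in_closed_alcove p -> left_minimal p d -> Wext d ->
  d <=B x -> fixer p a -> d <=B a * x.
Proof.
move=> hp dmin hd dx; move: a.
apply: (fixer_srefl_ind m_gt0 hp) => [|k a fk ha dax]; first by rewrite mul1g.
have hax := WextM (fixer_Wext ha) (ole_Wext dx hd).
have := lmin_mono m_gt0 k hd dax; rewrite {1}/lmin dmin // => h.
by rewrite -mulgA; apply: ole_trans h (lmin_le_srefl m_gt0 k hax).
Qed.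

(** The absence of descents on either side is a local condition; it already makes [d] the least
    element of its double coset. The right factor is treated by passing to inverses. *)
Lemma double_minimal_le p1 p2 d a b : in_closed_alcove p1 -> in_closed_alcove p2 ->
  Wext d -> left_minimal p1 d -> right_minimal p2 d ->
  fixer p1 a -> fixer p2 b -> d <=B a * d * b.
Proof.
move=> h1 h2 hd l1 l2 ha hb; rewrite -mulgA; apply: (left_minimal_le h1) => //.
have hd' := WextV hd.
have h : d^-1 <=B b^-1 * d^-1.
  apply: (left_minimal_le h2 _ hd') => //; last exact: fixerV.
  by move=> k fk; rewrite invgK; exact: l2.
by have := ole_inv hd' h; rewrite invMg !invgK.
Qed.

Lemma descend_minimal p1 p2 z : in_closed_alcove p1 -> in_closed_alcove p2 -> Wext z ->
  exists a b, [/\ fixer p1 a, fixer p2 b, left_minimal p1 (a * z * b),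
    right_minimal p2 (a * z * b) & a * z * b <=B z].
Proof.
move=> h1 h2; have [N] := ubnP (displ_norm z); elim: N z => // N IH z Nz hz.
have [l1|/existsNP[k /not_implyP[fk /negP pk]]] := EM (left_minimal p1 z); last first.
  have hs := srefl_Wext m_gt0 k.
  have [a [b [ha hb la lb le]]] :=
    IH _ (leq_trans (srefl_displ m_gt0 hz pk) Nz) (WextM hs hz).
  exists (a * s k), b; rewrite -mulgA; rewrite mulgA in le la lb.
  rewrite !mulgA; split=> //; last exact: ole_trans (srefl_down m_gt0 hz pk).
  by apply: fixerM => //; apply: srefl_fixer => //; exact: h1.1.
have [l2|/existsNP[k /not_implyP[fk /negP pk]]] := EM (right_minimal p2 z); last first.
  have hs := srefl_Wext m_gt0 k.
  have [a [b [ha hb la lb le]]] :=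
    IH _ (leq_trans (srefl_displ_right hz pk) Nz) (WextM hz hs).
  exists a, (s k * b); rewrite !mulgA in le la lb *.
  split=> //; last exact: ole_trans (srefl_down_right hz pk).
  by apply: fixerM => //; apply: srefl_fixer => //; exact: h2.1.
by exists 1, 1; rewrite mul1g mulg1; split=> //; exact: fixer1.
Qed.

End DoubleCosets.

(** The strong exchange condition. Along the word the root changes sign at some letter, which can
    then be deleted; the prefix before it conjugates this letter to the reflection, as the
    definition of [affine_refl] requires. *)
Lemma exchange l r : isroot r -> pos r != pos (root_act (word l)^-1 r) ->
  (exists2 l', (size l' < size l)%N & refl r * word l = word l')
  /\ exists k g, Waff g /\ refl r = g * s k * g^-1.
Proof.
have key : forall l r, isroot r -> pos r -> ~~ pos (root_act (word l)^-1 r) ->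
    (exists2 l', (size l' < size l)%N & refl r * word l = word l')
    /\ exists k g, Waff g /\ refl r = g * s k * g^-1.
  elim=> {l r} [|k l IH] r hr pr.
    by rewrite /word big_nil invg1 root_act1 pr.
  have hs := srefl_Wext m_gt0 k.
  rewrite word_cons invMg srefl_inv // root_actM => npr.
  have [psr|psr] := boolP (pos (root_act (s k) r)); last first.
    have [-> _] := sroot_only m_gt0 hr pr psr; split.
      by exists l; rewrite // mulgA srefl_sq // mul1g.
    by exists k, 1; split; [exact: Waff1|rewrite mul1g invg1 mulg1].
  have hsr : isroot (root_act (s k) r) by rewrite isroot_Wext.
  have [[l' l'l e] [j [g [hg e']]]] := IH _ hsr psr npr.
  have er : refl r = s k * refl (root_act (s k) r) * s k.
    by rewrite refl_conj // srefl_inv // !mulgA srefl_sq // mul1g -mulgA srefl_sq // mulg1.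
  split.
    exists (k :: l'); rewrite //= word_cons -e er !mulgA.
    by rewrite -[_ * s k * s k]mulgA srefl_sq // mulg1.
  exists j, (s k * g); split; first by apply: WaffM => //; exact: srefl_Waff.
  by rewrite er e' invMg srefl_inv // !mulgA.
move=> hr; case: (boolP (pos r)) => pr; first by move=> npr; apply: key => //; case: pos npr.
case: (boolP (pos _)) => // pr' _; rewrite -refl_neg //; apply: key.
- by rewrite isroot_neg.
- by rewrite pos_neg.
- by rewrite pos_act_neg ?pr' //; apply/WextV/Waff_Wext/word_Waff.
Qed.

Lemma Waff_word w : Waff w -> exists l, w = word l.
Proof.
have [N] := ubnP (displ_norm w); elim: N w => // N IH w Nw hw.
have Ww := Waff_Wext hw; have [[k hk]|pw] := simple_descent m_gt0 Ww.
  have [|l e] := IH _ (leq_trans (srefl_displ m_gt0 Ww hk) Nw).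
    by apply: WaffM => //; exact: srefl_Waff.
  by exists (k :: l); rewrite word_cons -e srefl_mulK.
exists [::]; rewrite /word big_nil; apply: (Waff_pos_id m_gt0 hw) => k.
by rewrite pw ?sroot_pos // sroot_root.
Qed.

End Bruhat.

(** * The order at infinity *)

Section ThetaOrder.
Variable m : nat.
Hypothesis m_gt0 : (0 < m)%N.
Local Notation n := m.*2.+1.
Local Notation aroot := ('I_n * 'I_n * int)%type.
Local Notation zn := (zaff n).
Local Notation s := (@srefl m).
Local Notation f := (@sroot m).
Local Notation "x <=B y" := (ole (@pos m) x y) (at level 70).
Implicit Types (r : aroot) (w g x y d : zn) (th la mu : 'rV[int]_n).
Hint Resolve ole_refl : core.

Definition regular th :=
  (forall i, th 0 (rev_ord i) = - th 0 i) /\ injective (fun i => th 0 i).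

(* The Bruhat order seen from a base alcove infinitely far in direction [- th]. *)
Definition otheta th r : bool := th 0 r.1.1 < th 0 r.1.2.

Definition dominant th la := forall i j, th 0 j < th 0 i -> la 0 j <= la 0 i.

Lemma regular_mid th : regular th -> th 0 (mid m) = 0.
Proof. by move=> [hr _]; have := hr (mid m); rewrite rev_mid; lia. Qed.

Lemma regular_balanced th : regular th -> balanced int m th.
Proof. by move=> h i; rewrite h.1 subrr regular_mid // mul0rn. Qed.

Lemma regular_perm (t : 'S_n) th : Sstar t -> regular th -> regular (permv t th).
Proof.
move=> ht [hr hi]; split=> [i|i j]; first by rewrite !mxE (SstarV ht) hr.
by rewrite !mxE => /hi/perm_inj.
Qed.

Lemma otheta_act th w r : otheta (permv (zaff_lin w) th) (root_act w r) = otheta th r.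
Proof. by rewrite /otheta !mxE !permK. Qed.

Lemma dominant_perm (t : 'S_n) th la :
  dominant (permv t th) (permv t la) -> dominant th la.
Proof. by move=> h i j ij; have := h (t i) (t j); rewrite !mxE !permK; exact. Qed.

Lemma mul_transl w la : (w * transl la = transl (permv (zaff_lin w) la) * w)%g.
Proof.
case: w => l t; rewrite /transl /mulg /= /zaff_mul /=; congr ZAff; last by rewrite mulg1 mul1g.
by rewrite permv1 addrC.
Qed.

Lemma transl_Wext la : balanced int m la -> Wext (transl la).
Proof. by move=> h; split=> //; exact: Sstar1. Qed.

Lemma transl_act (K : pzRingType) la (x : 'rV[K]_n) :
  zaff_act (transl la) x = map_mx intr la + x.
Proof. by apply/rowP => i; rewrite !mxE invg1 perm1. Qed.

Lemma permv_refl la r : isroot r -> balanced int m la ->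
  permv (refl_lin r.1.1 r.1.2) la = la - (la 0 r.1.1 - la 0 r.1.2) *: coroot r.
Proof.
move=> hr hl; apply/rowP => l; rewrite [LHS]mxE refl_linV // refl_lin_int //.
by rewrite [RHS]mxE; congr (_ + _); rewrite [RHS]mxE [in RHS]mxE.
Qed.

Lemma refl_refl_transl (i j : 'I_n) (k c : int) : is_root i j ->
  (refl (i, j, (k + c)%R) * refl (i, j, k) = transl (c *: coroot (i, j, 0)))%g.
Proof.
move=> hij; apply: (@zaff_ext m rat) => x hx.
have h1 : isroot (i, j, k) by []. have h2 : isroot (i, j, k + c) by [].
have hy : balanced rat m (zaff_act (refl (i, j, k)) x).
  by apply: balanced_act => //; exact: refl_Wext.
rewrite zaff_actM transl_act (refl_act h2 hy).
have -> : rval (i, j, k + c) (zaff_act (refl (i, j, k)) x) = - rval (i, j, k) x - c%:~R.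
  by rewrite -(rval_refl h1 hx) /rval /= intrD; ring.
rewrite refl_act //; apply/rowP => l.
have e (d0 : int) : (map_mx intr (coroot (i, j, d0)) : 'rV[rat]_n) 0 l
    = (coroot (i, j, 0) 0 l)%:~R.
  by rewrite [LHS]mxE.
have e1 (v1 v2 : 'rV[rat]_n) a : (v1 - a *: v2) 0 l = v1 0 l - a * v2 0 l by rewrite !mxE.
rewrite !e1 !e [RHS]mxE [X in _ = X + _]mxE [X in _ = X%:~R + _]mxE intrM; ring.
Qed.

Lemma transl_climb la th (i j : 'I_n) : balanced int m la -> regular th ->
  is_root i j -> la 0 i < la 0 j -> th 0 j < th 0 i ->
  ole (otheta th) (transl la) (transl (permv (refl_lin i j) la)).
Proof.
move=> hla hth hij lij tij.
(* The first hyperplane of direction (i, j) above the alcove translated by [la]. After reflecting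
   there, the parallel hyperplane k + c is still above because c >= 1, so both steps go up for [th];
   their product is the translation by c coroots. *)
pose k : int := la 0 i - la 0 j + (j < i)%N%:Z.
pose c : int := la 0 j - la 0 i.
have h1 : isroot (i, j, k) by []. have h2 : isroot (i, j, k + c) by [].
have Wla := transl_Wext hla; have W1 := refl_Wext h1.
have Hi := ltn_ord i; have Hj := ltn_ord j.
have ne : i != j :> nat by move: hij; rewrite /is_root ord_neq eq_sym => /andP[].
have E kk : root_act (transl la)^-1%g (i, j, kk) = (i, j, kk - la 0 i + la 0 j).
  by rewrite /root_act /= !mxE !invg1 !perm1 opprK.
apply: (@ole_trans _ _ (refl (i, j, k) * transl la)%g); apply: rt_step.
  exists (i, j, k); split=> //.
  rewrite /otheta /= ltNge ltW //=; apply/esym/negbTE.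
  rewrite E /pos /= /k.
  by case: (ltngtP i j) ne => //= ij _; nia.
exists (i, j, k + c); split=> //; last first.
  rewrite mulgA refl_refl_transl //; congr ZAff; last by rewrite mulg1.
  rewrite (permv_refl (r := (i, j, 0))) //= permv1 /c addrC.
  by rewrite -scaleNr opprB.
rewrite /otheta /= ltNge ltW //=; apply/esym/negbTE.
have hb : balanced rat m (zaff_act (transl la) (basept m rat)).
  by apply: balanced_act => //; exact: basept_balanced.
rewrite (posE rat) -rval_actV zaff_actM -leNgt.
have -> : rval (i, j, k + c) (zaff_act (refl (i, j, k)) (zaff_act (transl la) (basept m rat)))
    = - rval (i, j, k) (zaff_act (transl la) (basept m rat)) - c%:~R.
  by rewrite -(rval_refl h1 hb) /rval /= intrD; ring.
rewrite rval_actV.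
rewrite E (_ : k - la 0 i + la 0 j = (j < i)%N%:Z); last by rewrite /k; ring.
rewrite rval_basept /= -opprD oppr_le0 -[c%:~R](mulfK (_ : (m.*2.+2)%:R != 0)) ?pnatr_eq0 //.
rewrite -mulrDl divr_ge0 ?ler0n //.
rewrite pmulrn -intrM -intrD ler0z /c.
by case: (ltngtP i j) ne => //= ij _; nia.
Qed.

(** The pair (i, i') is not a root; it is compared through [mid], where [th] is 0. *)
Lemma dominant_of_roots th la : regular th -> balanced int m la ->
  (forall i j, is_root i j -> th 0 j < th 0 i -> la 0 j <= la 0 i) -> dominant th la.
Proof.
move=> hth hla H i j ij.
case: (boolP (is_root i j)) => [/H|]; first exact.
rewrite /is_root negb_and !negbK => /orP[/eqP e|/eqP e]; first by move: ij; rewrite e ltxx.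
have th0 := regular_mid hth; subst j; move: ij; rewrite hth.1 => ij.
have im : i != mid m by apply/eqP => e; move: ij; rewrite e th0; lia.
have Hi := ltn_ord i; move: (im); rewrite ord_neq val_mid => im'.
apply: (@le_trans _ _ (la 0 (mid m))); apply: H.
- by rewrite /is_root !ord_neq /= val_mid; lia.
- by rewrite hth.1 th0; lia.
- by rewrite /is_root !ord_neq /= val_mid; lia.
- by rewrite th0; lia.
Qed.

(* Reflecting [la] in a root with [la_i < la_j] and [th_j < th_i] increases the
   pairing with [th], so the process stops at a dominant weight. *)
Lemma climb mu th (t : 'S_n) : balanced int m mu -> regular th -> Sstar t ->
  exists t' : 'S_n, [/\ Sstar t', dominant th (permv t' mu)
    & ole (otheta th) (transl (permv t mu)) (transl (permv t' mu))].
Proof.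
move=> hmu hth.
pose val (la : 'rV[int]_n) := \sum_i th 0 i * la 0 i.
(* Termination: finitely many permutations can still give a larger pairing with [th]. *)
have [N] := ubnP #|[set u : 'S_n | val (permv t mu) < val (permv u mu)]|.
elim: N t => // N IH t Nt ht; have hla := balanced_perm ht hmu.
set la := permv t mu in Nt hla *.
have [dom|] := EM (dominant th la); first by exists t.
move=> ndom; have [i [j [hij tij lij]]] : exists i j,
    [/\ is_root i j, th 0 j < th 0 i & la 0 i < la 0 j].
  apply: contrapT => h; apply: ndom; apply: dominant_of_roots => // i j hij tij.
  by rewrite leNgt; apply/negP => lij; apply: h; exists i, j.
have hr : isroot (i, j, 0) by [].
have e : permv (refl_lin i j) la = permv (t * refl_lin i j)%g mu by rewrite permvM.
have hu : Sstar (t * refl_lin i j)%g by apply: SstarM => //; exact: refl_lin_Sstar.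
have lt_val : val la < val (permv (t * refl_lin i j)%g mu).
  rewrite -e (permv_refl (r := (i, j, 0))) //= /val.
  have -> : \sum_l th 0 l * (la - (la 0 i - la 0 j) *: coroot (i, j, 0)) 0 l
      = \sum_l th 0 l * la 0 l + (la 0 j - la 0 i) * \sum_l (coroot (i, j, 0) 0 l)%:~R * th 0 l.
    rewrite mulr_sumr -big_split; apply: eq_bigr => l _ /=.
    by rewrite [X in _ * X]mxE [X in _ + X]mxE [X in - X]mxE intz; ring.
  rewrite coroot_pairing; last exact: regular_balanced.
  rewrite ltrDl mulr_gt0 ?subr_gt0 //=.
  by rewrite mulr_gt0 ?subr_gt0 // /coroot_const; case: ifP.
have [|t' [ht' dom' le']] := IH _ _ hu.
  apply: leq_trans (Nt : (_ <= N)%N); apply: proper_card; apply/properP; split.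
    by apply/fintype.subsetP => u; rewrite !inE; apply: lt_trans.
  by exists (t * refl_lin i j)%g; rewrite !inE // ltxx.
exists t'; split=> //; apply: ole_trans le'; rewrite -e.
exact: transl_climb.
Qed.

(** Listed by increasing [th], both weights are sorted rearrangements of the coordinates of [mu]. *)
Lemma dominant_unique mu th (t u : 'S_n) : regular th ->
  dominant th (permv t mu) -> dominant th (permv u mu) -> permv t mu = permv u mu.
Proof.
move=> hth ht hu.
pose le_th (i j : 'I_n) := th 0 i <= th 0 j.
have le_tr : transitive le_th by move=> a b c; exact: le_trans.
have le_tot : total le_th by move=> a b; exact: le_total.
pose e := sort le_th (enum 'I_n).
have es : sorted le_th e by exact: sort_sorted.
have key la : dominant th la -> sorted <=%R [seq la 0 i | i <- e].
  move=> hla; rewrite sorted_map; apply: sub_sorted es => i j /=; rewrite /le_th le_eqVlt.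
  by case/orP => [/eqP/hth.2->//|/hla].
have perm_e (a b : 'S_n) : perm_eq [seq permv a mu 0 i | i <- e] [seq permv b mu 0 i | i <- e].
  have h (a0 : 'S_n) : perm_eq [seq permv a0 mu 0 i | i <- e] [seq mu 0 i | i <- enum 'I_n].
    have -> : [seq permv a0 mu 0 i | i <- e] = [seq mu 0 i | i <- [seq a0^-1%g i | i <- e]].
      by rewrite -map_comp; apply: eq_map => i /=; rewrite mxE.
    apply: perm_map; apply: uniq_perm; rewrite ?enum_uniq //.
      by rewrite map_inj_uniq ?sort_uniq ?enum_uniq //; exact: perm_inj.
    move=> i; rewrite mem_enum inE; apply/mapP; exists (a0 i); last by rewrite permK.
    by rewrite mem_sort mem_enum.
  by apply: perm_trans (h a) _; rewrite perm_sym.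
have E : [seq permv t mu 0 i | i <- e] = [seq permv u mu 0 i | i <- e].
  by apply: (sorted_eq le_trans le_anti); [exact: key|exact: key|exact: perm_e].
apply/rowP => i; have /eq_in_map := E; apply.
by rewrite mem_sort mem_enum.
Qed.

(* Going down a Bruhat step [x -> s x], either this step is also one for [th], or
   the inequality for [s th] at [s x], multiplied by [s], gives the one for [th]. *)
Lemma admissible_theta mu x (t0 : 'S_n) : balanced int m mu -> Sstar t0 -> Wext x ->
  x <=B transl (permv t0 mu) ->
  forall th, regular th -> exists t : 'S_n,
    [/\ Sstar t, dominant th (permv t mu) & ole (otheta th) x (transl (permv t mu))].
Proof.
move=> hmu ht0 hx h.
pose P y := forall th, regular th -> exists t : 'S_n,
    [/\ Sstar t, dominant th (permv t mu) & ole (otheta th) y (transl (permv t mu))].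
have step y z : Wext y -> ostep (@pos m) y z -> P z -> P y.
  move=> hy [r [hr pr ->]] Pz th hth.
  have Ws := refl_Wext hr; have [_ hs] := Ws.
  have [e|ne] := eqVneq (otheta th r) (pos (root_act y^-1%g r)).
    have [t [ht dom le]] := Pz th hth; exists t; split=> //.
    by apply: ole_trans le; apply: rt_step; exists r.
  have [t [ht dom le]] := Pz _ (regular_perm hs hth).
  have := ole_mull Ws le; rewrite mulgA refl_sq // mul1g mul_transl => le1.
  have le2 : ole (otheta th) y (transl (permv (t * zaff_lin (refl r))%g mu) * refl r)%g.
    rewrite permvM; apply: eq_ole le1 => r0 hr0.
    by rewrite refl_inv // /otheta /= !mxE refl_linV // !(refl_linK hr).
  have hu := SstarM ht hs.
  (* The reflection is still on the right of the translation. Removing it is a step in a root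
     parallel to [r], hence with the same orientation for [th]; it goes up exactly because [ne]
     holds. *)
  have [t' [ht' dom' le']] := climb hmu hth hu.
  exists t'; split=> //; apply: ole_trans le2 _; apply: ole_trans le'; apply: rt_step.
  set tl := transl _; have htl : Wext tl by apply/transl_Wext/balanced_perm.
  exists (root_act tl r); split.
  - by rewrite isroot_Wext.
  - have flip := pos_refl m_gt0 (Wext1 m) hr; rewrite !root_act1 in flip.
    rewrite invMg root_actM root_actK refl_inv // flip.
    have -> : otheta th (root_act tl r) = otheta th r by rewrite /otheta /root_act /= !perm1.
    by move: ne; rewrite -pr; case: (otheta th r); case: (pos r).
  - by rewrite refl_conj // !mulgA mulgVK -mulgA refl_sq // mulg1.
suff : P (transl (permv t0 mu)) -> P x by apply => th hth; exact: climb.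
elim: h hx => {x} [y z h hy|//|y z w h0 h1 _ h2 hy]; first exact: step h.
by move=> Pw; apply: h1 => //; apply: h2 => //; exact: ole_Wext h0 hy.
Qed.

Lemma far_pos th r : regular th -> isroot r ->
  exists N0 : nat, forall N : nat, (N0 <= N)%N ->
    pos (root_act (transl (N%:Z *: th)) r) = otheta th r.
Proof.
move=> hth; case: r => [[i j] d]; rewrite /isroot /is_root /= => /andP[ij _].
have Hi := ltn_ord i; have Hj := ltn_ord j.
have ne : th 0 i != th 0 j.
  by apply: contraNneq ij => /hth.2->.
(* Distinct integral coordinates of [th] differ by at least 1, so N times the difference outweighs
   d. *)
exists (absz d).+1 => N hN; rewrite /pos /otheta /root_act /= !perm1 !mxE.
move: ne; rewrite neq_lt => /orP[lt|gt].
  have : d + N%:Z * th 0 i - N%:Z * th 0 j <= -1 by nia.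
  rewrite lt; move: (d + _ - _) => a a1.
  by have -> : a * (m.*2.+2)%:Z < i%:Z - j%:Z by nia.
rewrite [RHS]ltNge ltW //=; apply/negbTE; rewrite -leNgt.
have : 1 <= d + N%:Z * th 0 i - N%:Z * th 0 j by nia.
by move: (d + _ - _) => a a1; nia.
Qed.

Lemma far_ole th x y : regular th -> ole (otheta th) x y ->
  exists N0 : nat, forall N : nat, (N0 <= N)%N ->
    (transl (N%:Z *: th) * x)%g <=B (transl (N%:Z *: th) * y)%g.
Proof.
move=> hth; elim=> {x y} [x y [r [hr e ->]]|x|x y z _ [N1 h1] _ [N2 h2]].
- have [N0 h] := far_pos hth hr; exists N0 => N hN; set g := transl _.
  have hg : Wext g by apply/transl_Wext/balancedZ/regular_balanced.
  apply: rt_step; exists (root_act g r); split.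
  + by rewrite isroot_Wext.
  + by rewrite invMg root_actM root_actK h.
  + by rewrite refl_conj // !mulgA mulgVK.
- by exists 0%N.
- exists (maxn N1 N2) => N; rewrite geq_max => /andP[hN1 hN2].
  exact: ole_trans (h1 _ hN1) (h2 _ hN2).
Qed.

(* Ranks for the lexicographic order on pairs [(de_i, i)]. *)
Lemma regular_refinement (K : realFieldType) (de : 'rV[K]_n) : balanced K m de ->
  exists2 th, regular th & forall i j, de 0 i < de 0 j -> th 0 i < th 0 j.
Proof.
move=> hde.
pose prec (i j : 'I_n) := (de 0 i < de 0 j) || ((de 0 i == de 0 j) && (i < j)%N).
have prec_irr i : prec i i = false by rewrite /prec ltxx eqxx ltnn.
have prec_tr : transitive prec.
  move=> b a c; rewrite /prec => /orP[h1|/andP[/eqP-> h1]] /orP[h2|/andP[/eqP e h2]].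
  - by rewrite (lt_trans h1 h2).
  - by rewrite -e h1.
  - by rewrite h2.
  - by rewrite e eqxx (ltn_trans h1 h2) orbT.
have prec_tot i j : i != j -> prec i j || prec j i.
  rewrite ord_neq /prec; case: (ltrgtP (de 0 i) (de 0 j)) => //= _.
  by case: ltngtP.
have prec_rev i j : prec (rev_ord i) (rev_ord j) = prec j i.
  have e (l : 'I_n) : de 0 (rev_ord l) = de 0 (mid m) *+ 2 - de 0 l by rewrite -(hde l); ring.
  have Hi := ltn_ord i; have Hj := ltn_ord j.
  rewrite /prec !e ltrD2l ltrN2 (inj_eq (addrI _)) eqr_opp eq_sym.
  by congr (_ || (_ && _)) => /=; lia.
pose th : 'rV[int]_n := \row_i \sum_j ((prec j i)%:Z - (prec i j)%:Z).
have mono i j : prec i j -> th 0 i < th 0 j.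
  move=> ij; rewrite !mxE (bigD1 i) //= [ltRHS](bigD1 i) //= prec_irr ij.
  have ji : prec j i = false.
    by apply/negbTE/negP => ji; have := prec_tr _ _ _ ij ji; rewrite prec_irr.
  rewrite ji; apply: ltr_leD => //; apply: ler_sum => l _.
  have h1 : prec l i -> prec l j by move=> li; exact: prec_tr li ij.
  have h2 : prec j l -> prec i l by exact: prec_tr.
  move: h1 h2; case: (prec l i) => [/(_ isT)->|_]; case: (prec j l) => [/(_ isT)->|_];
    by case: (prec l j); case: (prec i l).
exists th; last by move=> i j ij; apply: mono; rewrite /prec ij.
split=> [i|i j /= e].
  rewrite !mxE (reindex_inj rev_ord_inj) -sumrN; apply: eq_bigr => j _.
  by rewrite !prec_rev opprB.
apply/eqP; apply: contraT => /prec_tot/orP[/mono|/mono]; by rewrite e ltxx.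
Qed.

(* With [th] pointing from the base point towards the image [x p] of the facet,
   [x] is minimal in its coset also from far away, so that Deodhar's criterion
   applies there, and the lengths of the far translation and of [x] add up. *)
Theorem vertexwise_admissible (K : realFieldType) (p : 'rV[K]_n) mu x :
  in_closed_alcove p -> balanced int m mu -> Wext x -> right_minimal p x ->
  (forall k, 0 < rval (f k) p -> exists a b (t : 'S_n),
     [/\ fixer (vertex K k) a, fixer (vertex K k) b, Sstar t
       & (a * x * b)%g <=B transl (permv t mu)]) ->
  exists2 t : 'S_n, Sstar t & x <=B transl (permv t mu).
Proof.
move=> hp hmu hx xmin H; have hb := basept_balanced m_gt0 K.
have hxp : balanced K m (zaff_act x p) by apply: balanced_act => //; exact: hp.1.
have [th hth deth] := regular_refinement (balancedD hxp (balancedN hb)).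
have [t [ht dom _]] := climb hmu hth (@Sstar1 m).
exists t => //; set la := permv t mu.
have hla : balanced int m la by exact: balanced_perm.
have Wla := transl_Wext hla.
(* Such a root strictly decreases from the base point to [x p]; only strict inequalities must
   survive the refinement to a regular [th]. *)
have toward r : isroot r -> pos r -> rval r (zaff_act x p) <= 0 -> otheta th r.
  rewrite (posE K) => hr pr rp; apply: deth; move: rp pr.
  have e (v1 v2 : 'rV[K]_n) l : (v1 - v2) 0 l = v1 0 l - v2 0 l by rewrite !mxE.
  by rewrite !e /rval => rp pr; lra.
(* For these roots any N will do; a large N is needed only to convert the chains of [far]. *)
have towardN N r : isroot r -> pos r -> rval r (zaff_act x p) <= 0 ->
    pos (root_act (transl (N%:Z *: th)) r).
  move=> hr pr rp; have := toward _ hr pr rp; case: r hr pr rp => [[i j] d] _ + _.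
  rewrite /pos /otheta /root_act /= !perm1 !mxE => pr tij; apply: le_lt_trans pr.
  have h : N%:Z * th 0 i <= N%:Z * th 0 j by rewrite ler_wpM2l // ltW.
  by rewrite ler_pM2r // -addrA gerDl subr_le0.
have far k : exists N0, forall N, (N0 <= N)%N -> 0 < rval (f k) p ->
    exists2 u, fixer (vertex K k) u &
      (transl (N%:Z *: th) * x * u)%g <=B (transl (N%:Z *: th) * transl la)%g.
  have [fk|fk] := boolP (0 < rval (f k) p); last by exists 0%N.
  have [a [b [t0 [ha hb' ht0 le0]]]] := H k fk.
  have Wa := fixer_Wext ha; have Wb := fixer_Wext hb'.
  have [_ hsa] := Wa; have hv := vertex_closed m_gt0 K k.
  have Waxb := WextM (WextM Wa hx) Wb.
  have [t' [ht' dom' le']] := admissible_theta hmu ht0 Waxb le0 (regular_perm hsa hth).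
  have := ole_mull (WextV Wa) le'; rewrite invgK -!mulgA mulKg mul_transl -permvM.
  have -> : permv (t' * zaff_lin a^-1)%g mu = la.
    apply: (dominant_unique hth) => //; apply: (@dominant_perm (zaff_lin a)).
    by rewrite permvM -[permv _ (permv _^-1%g _)]permvM mulVg permv1.
  move=> le1; have le2 : ole (otheta th) (x * b)%g (transl la * a^-1)%g.
    by apply: eq_ole le1 => r hr; rewrite otheta_act.
  have [N0 h] := far_ole hth le2; exists N0 => N /h{}h _; set g := transl _ in h *.
  have Wg : Wext g by apply/transl_Wext/balancedZ/regular_balanced.
  (* Multiplying on the right by [a] frees the translation from [a^-1]; the lower element changes
     within the vertex fixer only. *)
  have [u hu hle] := project_right m_gt0 hv (WextM Wg (WextM hx Wb)) ha h.
  exists (b * u)%g; first exact: fixerM.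
  by move: hle; rewrite !mulgA mulgVK.
have [N0 hN0] := choice far.
pose N := (\max_k N0 k)%N; set g := transl (N%:Z *: th).
have Wg : Wext g by apply/transl_Wext/balancedZ/regular_balanced.
have gx : right_minimal p (g * x)%g.
  move=> k fk; rewrite root_actM; apply: towardN.
  - by rewrite isroot_Wext // sroot_root.
  - exact: xmin.
  - by rewrite rval_act fk.
have le : (g * x)%g <=B (g * transl la)%g.
  apply: (deodhar m_gt0 hp gx); try exact: WextM.
  by move=> k fk; apply: hN0 fk; exact: leq_bigmax.
apply: (cancel_left m_gt0 Wg hx Wla _ le) => r hr pr npr.
apply: towardN => //; rewrite rval_actV -oppr_ge0 -rval_neg.
apply: (closed_alcove_pos m_gt0 hp); rewrite ?isroot_neg ?pos_neg ?isroot_Wext //;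
  exact: WextV.
Qed.

End ThetaOrder.

(** * Facets of the apartment *)

Section Facets.
Variables (R : realType) (m : nat).
Hypothesis m_gt0 : (0 < m)%N.
Local Notation n := m.*2.+1.
Local Notation aroot := ('I_n * 'I_n * int)%type.
Local Notation zn := (zaff n).
Local Notation s := (@srefl m).
Local Notation f := (@sroot m).
Local Notation rowR := 'rV[R]_n.
Local Open Scope classical_set_scope.
Implicit Types (r : aroot) (w g : zn) (p x y z : rowR).

Definition facet_of p : set rowR := [set y | apt y /\ same_side p y].

Lemma same_sideP x y :
  same_side x y <-> forall r, isroot r -> Num.sg (rval r x) = Num.sg (rval r y).
Proof.
split=> [h [[i j] d] hr|h i j d hij]; first exact: h.
exact: (h (i, j, d)).
Qed.

Lemma facet_of_self p : apt p -> facet_of p p. Proof. by []. Qed.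

Lemma facet_of_eq0 p y r : facet_of p y -> isroot r -> (rval r y == 0) = (rval r p == 0).
Proof. by move=> [_ /same_sideP h] hr; rewrite -sgr_eq0 -(h r hr) sgr_eq0. Qed.

Lemma facet_of_gt0 p y r : facet_of p y -> isroot r -> (0 < rval r y) = (0 < rval r p).
Proof. by move=> [_ /same_sideP h] hr; rewrite -sgr_gt0 -(h r hr) sgr_gt0. Qed.

Lemma closure_rval_ge0 (S : set rowR) z r : closure S z ->
  (forall y, S y -> 0 <= rval r y) -> 0 <= rval r z.
Proof.
move=> cz h; rewrite leNgt; apply/negP => rz.
pose e := - rval r z / 2; have e0 : 0 < e by rewrite /e; lra.
have [y [/h ry ball_y]] := cz _ (nbhsx_ballx z e e0).
have b l : `|z 0 l - y 0 l| < e by exact: (ball_y.2 0 l).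
move: (b r.1.1) (b r.1.2); rewrite !ltr_norml => /andP[a1 a2] /andP[b1 b2].
by move: ry rz; rewrite /e /rval in a1 a2 b1 b2 *; lra.
Qed.

Lemma closure_rval_eq0 (S : set rowR) z r : closure S z ->
  (forall y, S y -> rval r y = 0) -> rval r z = 0.
Proof.
move=> cz h; apply/eqP; rewrite eq_le -oppr_ge0 -rval_neg.
by rewrite !(closure_rval_ge0 cz) // => y /h; rewrite ?rval_neg => ->; rewrite ?oppr0.
Qed.

Lemma segment_closure (S : set rowR) p y :
  (forall t, 0 < t -> t <= 1 -> S ((1 - t) *: y + t *: p)) -> closure S y.
Proof.
move=> h B /nbhs_ballP[e /= e0 eB].
pose M := \sum_i `|p 0 i - y 0 i| + 1.
have M1 : 1 <= M by rewrite /M lerDr sumr_ge0.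
have M0 : 0 < M by apply: lt_le_trans M1.
pose t := Num.min 1 (e / (2 * M)).
have t0 : 0 < t by rewrite lt_min ltr01 divr_gt0 // mulr_gt0.
have t1 : t <= 1 by rewrite ge_min lexx.
exists ((1 - t) *: y + t *: p); split; first exact: h.
apply: eB; split=> // i j; rewrite (ord1 i) /ball /= !mxE.
have -> : y 0 j - ((1 - t) * y 0 j + t * p 0 j) = - (t * (p 0 j - y 0 j)) by ring.
rewrite normrN normrM gtr0_norm //.
have pj : `|p 0 j - y 0 j| <= M.
  rewrite /M (bigD1 j) //= -addrA lerDl addr_ge0 // sumr_ge0 //.
apply: le_lt_trans (ler_wpM2l (ltW t0) pj) _.
have te : t <= e / (2 * M) by rewrite ge_min lexx orbT.
apply: le_lt_trans (ler_wpM2r (ltW M0) te) _.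
rewrite invfM mulrA mulfVK ?gt_eqF // ltr_pdivrMr //; lra.
Qed.

Lemma base_alcoveE y : base_alcove R m y <-> apt y /\ forall k, 0 < rval (f k) y.
Proof.
have inordS k : (k < m.+1)%N -> (inord k : 'I_n) = k :> nat.
  by move=> hk; rewrite inordK //; lia.
split=> [[hy y01 ymax ymono]|[hy fy]].
  split=> // k; have Hk := ltn_ord k; rewrite /rval /sroot; case: ifPn => /= k0.
    by move: ymax; rewrite subr_gt0 mulrNz; lra.
  move: k0; rewrite ord_neq /= => k0; rewrite subr0 subr_gt0.
  have [k1|k1] := eqVneq (k : nat) 1%N.
    by rewrite k1 /= (_ : inord 0 = ord0) //; apply: val_inj; rewrite /= inordK.
  by apply: ymono; rewrite !inordS //; lia.
have lt (i j : 'I_n) : (i < j)%N -> (i + j != m.*2)%N -> y 0 i < y 0 j.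
  move=> ij rij; have Hi := ltn_ord i; have Hj := ltn_ord j.
  have h1 : isroot (j, i, 0) by rewrite /isroot /is_root !ord_neq /=; lia.
  have p1 : pos (j, i, 0) by rewrite /pos /=; lia.
  have := open_alcove_pos m_gt0 hy fy h1 p1.
  by rewrite /rval /= subr0 subr_gt0.
split=> // [||i j i1 ij jm].
- by apply: lt; rewrite inordS //=; lia.
- by have := fy ord0; rewrite /rval /sroot eqxx /= mulrNz; lra.
- by apply: lt => //; lia.
Qed.

Lemma base_alcove_facet : base_alcove R m = facet_of (basept m R).
Proof.
apply/seteqP; split=> y.
  move=> /base_alcoveE[hy fy]; split=> //; apply/same_sideP => r hr.
  case: (boolP (pos r)) => pr.
    by rewrite !gtr0_sg // -?posE // (open_alcove_pos m_gt0 hy).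
  have hr' : isroot (rneg r) by rewrite isroot_neg.
  have pr' : pos (rneg r) by rewrite pos_neg.
  rewrite !ltr0_sg // -oppr_gt0 -rval_neg -?posE //.
  exact: (open_alcove_pos m_gt0 hy).
move=> hy; apply/base_alcoveE; split=> [|k]; first exact: hy.1.
by rewrite (facet_of_gt0 hy (sroot_root m_gt0 k)) -posE sroot_pos.
Qed.

Lemma basept_open k : 0 < rval (f k) (basept m R).
Proof. by rewrite -posE sroot_pos. Qed.

Lemma subfacet_base_closed p : apt p -> subfacet (facet_of p) (base_alcove R m) ->
  in_closed_alcove p.
Proof.
move=> hp h; split=> // k; apply: (closure_rval_ge0 (h _ (facet_of_self hp))).
by move=> y /base_alcoveE[_ fy]; exact: ltW.
Qed.

Lemma subfacet_eq0 p p' r : apt p -> subfacet (facet_of p) (facet_of p') -> isroot r ->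
  rval r p' = 0 -> rval r p = 0.
Proof.
move=> hp h hr e; apply: (closure_rval_eq0 (h _ (facet_of_self hp))) => y hy.
by apply/eqP; rewrite (facet_of_eq0 hy hr) e.
Qed.

Lemma subfacet_closed p p' : apt p -> in_closed_alcove p' ->
  subfacet (facet_of p) (facet_of p') -> in_closed_alcove p.
Proof.
move=> hp hp' h; split=> // k; apply: (closure_rval_ge0 (h _ (facet_of_self hp))).
move=> y hy; have hk := sroot_root m_gt0 k; rewrite leNgt -oppr_gt0 -rval_neg.
rewrite (facet_of_gt0 hy) ?isroot_neg // rval_neg oppr_gt0 -leNgt.
exact: hp'.2.
Qed.

Lemma closed_facet_of p y : in_closed_alcove p -> facet_of p y -> in_closed_alcove y.
Proof.
move=> hp hy; split=> [|k]; first exact: hy.1.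
rewrite leNgt -oppr_gt0 -rval_neg.
rewrite (facet_of_gt0 hy) ?isroot_neg ?sroot_root // rval_neg oppr_gt0 -leNgt.
exact: hp.2.
Qed.

(** Among faces of the base alcove, the closure order is reverse inclusion of the sets of walls: a
    point of the smaller facet is approached along the segment to [p], whose other points have the
    signs of [p]. *)
Lemma subfacet_of_closed p z : in_closed_alcove p -> in_closed_alcove z ->
  (forall k, rval (f k) p = 0 -> rval (f k) z = 0) ->
  subfacet (facet_of z) (facet_of p).
Proof.
move=> hp hz pz y hy; have cy := closed_facet_of hz hy.
have py k : rval (f k) p = 0 -> rval (f k) y = 0.
  move=> /pz e; apply/eqP.
  by rewrite (facet_of_eq0 hy (sroot_root m_gt0 k)) e.
apply: segment_closure => t t0 t1; split.
  by apply: balanced_segment; [exact: cy.1|exact: hp.1].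
apply/same_sideP => r hr; rewrite rval_segment.
have key r0 : isroot r0 -> pos r0 ->
    Num.sg (rval r0 p) = Num.sg ((1 - t) * rval r0 y + t * rval r0 p).
  move=> h0 p0; have y0 := closed_alcove_pos m_gt0 cy h0 p0.
  have [e|ne] := eqVneq (rval r0 p) 0.
    by rewrite (root_vanish m_gt0 hp cy.1 py h0 e) e !mulr0 addr0.
  have pp : 0 < rval r0 p by rewrite lt_def ne (closed_alcove_pos m_gt0 hp).
  have h1 : 0 <= (1 - t) * rval r0 y by rewrite mulr_ge0 // subr_ge0.
  by rewrite !gtr0_sg //; apply: ltr_wpDl => //; exact: mulr_gt0.
case: (boolP (pos r)) => pr; first exact: key.
have := key (rneg r); rewrite isroot_neg pos_neg // => /(_ hr pr).
by rewrite !rval_neg !mulrN -opprD !sgrN => /oppr_inj.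
Qed.

(** Stabilizing the facet keeps [p] in the closed alcove, a fundamental domain, so [p] is fixed.
    Conversely, an element fixing [p] permutes roots without changing their signs at [p]. *)
Lemma facet_stabE p w : in_closed_alcove p -> facet_stab (facet_of p) w <-> fixer p w.
Proof.
move=> hp; have pp := facet_of_self hp.1; split=> -[hw].
  move=> e; have wp : facet_of p (zaff_act w p) by rewrite -e; exists p.
  split=> //; have [] // := fundamental_domain m_gt0 hp _ hw.
  exact: closed_facet_of wp.
move=> wp; have Ww := Waff_Wext hw; split=> //.
have key g y : fixer p g -> facet_of p y -> facet_of p (zaff_act g y).
  move=> [hg gp] hy; have Wg := Waff_Wext hg.
  split; first by apply: balanced_act => //; exact: hy.1.
  apply/same_sideP => r hr; rewrite rval_actV -[in LHS]gp rval_actV.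
  have /same_sideP := hy.2; apply; rewrite isroot_Wext //; exact: WextV.
apply/seteqP; split=> y; first by case=> x hx <-; exact: key.
move=> hy; exists (zaff_act w^-1%g y); last by rewrite -zaff_actM mulgV zaff_act1.
by apply: key => //; exact: fixerV.
Qed.

End Facets.

(** * Simple reflections, length and Bruhat order on the apartment *)

Section Interface.
Variables (R : realType) (m : nat).
Hypothesis m_gt0 : (0 < m)%N.
Local Notation n := m.*2.+1.
Local Notation aroot := ('I_n * 'I_n * int)%type.
Local Notation zn := (zaff n).
Local Notation s := (@srefl m).
Local Notation f := (@sroot m).
Local Notation rowR := 'rV[R]_n.
Local Notation "x <=B y" := (ole (@pos m) x y) (at level 70).
Local Open Scope classical_set_scope.
Implicit Types (r : aroot) (w g v t : zn) (p x y z : rowR).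
Hint Resolve ole_refl : core.

Definition hyperplane r : set rowR := root_hyperplane R r.1.1 r.1.2 r.2.

Lemma hyperplaneE r x : hyperplane r x <-> apt x /\ rval r x = 0.
Proof.
rewrite /hyperplane /root_hyperplane /= /rval; split=> -[hx].
  by move=> ->; rewrite subrr.
by move/eqP; rewrite subr_eq0 => /eqP.
Qed.

Lemma rval_mid r x y : rval r (2^-1 *: (x + y)) = 2^-1 * (rval r x + rval r y).
Proof. by rewrite /rval !mxE; field. Qed.

Lemma refl_is_reflection r : isroot r -> is_reflection_across (hyperplane r) (refl r).
Proof.
move=> hr x hx; have hy := balanced_act (refl_Wext hr) hx; split.
  apply/hyperplaneE; split; first by apply/balancedZ/balancedD.
  by rewrite rval_mid rval_refl // subrr mulr0.
move=> y z /hyperplaneE[hy' ry] /hyperplaneE[hz' rz].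
rewrite refl_act // addrAC subrr sub0r /dotv.
have -> : \sum_i (- (rval r x *: map_mx intr (coroot r) : rowR)) 0 i * (y - z) 0 i
    = - rval r x * \sum_i (coroot r 0 i)%:~R * (y - z) 0 i.
  rewrite mulr_sumr; apply: eq_bigr => i _; rewrite !mulrA; congr (_ * _).
  by rewrite [LHS]mxE [X in - X]mxE [X in _ * X]mxE mulNr.
rewrite coroot_pairing; last by apply/balancedD/balancedN.
have -> : (y - z) 0 r.1.1 - (y - z) 0 r.1.2 = rval r y - rval r z.
  by rewrite /rval !mxE; ring.
by rewrite ry rz subrr !mulr0.
Qed.

(** The two midpoints lie on the hyperplane and differ by half of [a - b], to which [a - x] and
    [b - x] are both orthogonal; so [a - b] is orthogonal to itself. *)
Lemma reflection_unique r w g : Wext w -> Wext g ->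
  is_reflection_across (hyperplane r) w -> is_reflection_across (hyperplane r) g -> w = g.
Proof.
move=> hw hg rw rg; apply: (@zaff_ext m R) => x hx.
have [hw1 hw2] := rw x hx; have [hg1 hg2] := rg x hx.
have := hw2 _ _ hw1 hg1; have := hg2 _ _ hw1 hg1.
set a := zaff_act w x; set b := zaff_act g x => e2 e1.
have : \sum_i ((a - b) 0 i) ^+ 2 = 0.
  transitivity (2 * (dotv (a - x) (2^-1 *: (x + a) - 2^-1 *: (x + b))
                     - dotv (b - x) (2^-1 *: (x + a) - 2^-1 *: (x + b)))); last first.
    by rewrite e1 e2 subrr mulr0.
  rewrite /dotv -sumrB mulr_sumr; apply: eq_bigr => i _.
  by move: (a) (b) => a' b'; rewrite !mxE; field.
move=> /psumr_eq0P h0; apply/rowP => i.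
have /eqP := h0 (fun i _ => sqr_ge0 _) i isT.
by rewrite sqrf_eq0 !mxE subr_eq0 => /eqP.
Qed.

Lemma srefl_is_simple k : simple_refl R (s k).
Proof.
have hk := sroot_root m_gt0 k; split; first exact: srefl_Waff.
exists (hyperplane (f k)); last exact: refl_is_reflection.
split; first by exists (f k).1.1, (f k).1.2, (f k).2.
have [z [hz zk zj]] := wall_point m_gt0 R k; exists (facet_of z).
have cz : in_closed_alcove z.
  by split=> // j; have [->|/zj/ltW//] := eqVneq j k; rewrite zk.
split; first by exists z.
  rewrite base_alcove_facet //; apply: subfacet_of_closed => //.
    split; first exact: basept_balanced.
    by move=> j; apply/ltW/basept_open.
  by move=> j e; have := basept_open R m_gt0 j; rewrite e ltxx.
apply/seteqP; split=> x.
  move=> [hx]; apply; first by exists (f k).1.1, (f k).1.2, (f k).2.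
  move=> y hy; apply/hyperplaneE; split; first exact: hy.1.
  by apply/eqP; rewrite (facet_of_eq0 hy hk) zk.
move=> /hyperplaneE[hx fx]; split=> // _ [i [j [d [hij ->]]]] zsub.
have /(hyperplaneE (i, j, d))[_ rz] := zsub _ (facet_of_self hz).
apply/(hyperplaneE (i, j, d)); split=> //.
have key r : isroot r -> pos r -> rval r z = 0 -> rval r x = 0.
  move=> hr pr rz0; have [c _ ->] // := wall_root m_gt0 hz zj zk hr pr rz0.
  by rewrite fx mulr0.
case: (boolP (pos (i, j, d))) => pr; first exact: key.
have hr : isroot (i, j, d) by [].
apply/eqP; rewrite -oppr_eq0 -rval_neg; apply/eqP; apply: key.
- by rewrite isroot_neg.
- by rewrite pos_neg.
- by rewrite rval_neg rz oppr0.
Qed.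

Lemma simple_reflP w : simple_refl R w -> exists k, w = s k.
Proof.
move=> [hw [_ [[i [j [d [hij ->]]]] [g [[z hz ->] gA gH]]] wr]].
set r : aroot := (i, j, d); have hr : isroot r by [].
have -> : w = refl r.
  apply: (@reflection_unique r) => //; first exact: Waff_Wext.
    exact: refl_Wext.
  exact: refl_is_reflection.
have cz := subfacet_base_closed m_gt0 hz gA.
have [k fk] : exists k, rval (f k) z = 0.
  apply: contrapT => h.
  have oz k : 0 < rval (f k) z.
    by rewrite lt_def cz.2 andbT; apply/eqP => e; apply: h; exists k.
  have : (facet_support (facet_of z)) z by split=> // H _; apply; exact: facet_of_self.
  rewrite gH => /(hyperplaneE r)[_ rz].
  case: (boolP (pos r)) => pr.
    by have := open_alcove_pos m_gt0 hz oz hr pr; rewrite rz ltxx.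
  have hr' : isroot (rneg r) by rewrite isroot_neg.
  have pr' : pos (rneg r) by rewrite pos_neg.
  by have := open_alcove_pos m_gt0 hz oz hr' pr'; rewrite rval_neg rz oppr0 ltxx.
exists k; have hk := sroot_root m_gt0 k.
have sub x : hyperplane r x -> rval (f k) x = 0.
  move=> hx; have : facet_support (facet_of z) x by rewrite gH.
  case=> _ /(_ (hyperplane (f k))) h.
  suff /hyperplaneE[] : hyperplane (f k) x by [].
  apply: h; first by exists (f k).1.1, (f k).1.2, (f k).2.
  move=> y hy; apply/hyperplaneE; split; first exact: hy.1.
  by apply/eqP; rewrite (facet_of_eq0 hy hk) fk.
(* The value of wall k on the coroot of [r]. As wall k vanishes at the midpoint of [x] and its
   mirror image, it is al / 2 times [r]. *)
pose al : R := (coroot r 0 (f k).1.1)%:~R - (coroot r 0 (f k).1.2)%:~R.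
apply/esym/(@proportional_refl m R _ _ (2^-1 * al)) => // x hx.
have [/sub e _] := refl_is_reflection hr hx.
move: e; rewrite rval_mid refl_act //.
have -> : rval (f k) (x - rval r x *: map_mx intr (coroot r)) = rval (f k) x - rval r x * al.
  have e1 (v1 v2 : rowR) a l : (v1 - a *: v2) 0 l = v1 0 l - a * v2 0 l by rewrite !mxE.
  rewrite [LHS]/rval !e1 /al.
  have e2 l : (map_mx intr (coroot r) : rowR) 0 l = (coroot r 0 l)%:~R by rewrite [LHS]mxE.
  by rewrite !e2 /rval; ring.
by lra.
Qed.

Lemma is_word_ofP w (u : seq zn) :
  is_word_of R w u <-> exists2 l, u = [seq s k | k <- l] & w = word l.
Proof.
split=> [[hu ->]|[l -> ->]]; last first.
  split; last by rewrite /word big_map.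
  by move=> x /mapP[k _ ->]; exact: srefl_is_simple.
elim: u hu => [|x u IH] hu; first by exists [::]; rewrite /word ?big_nil.
have [k xk] : exists k, x = s k by apply/simple_reflP/hu; rewrite inE eqxx.
have [l ul el] := IH (fun (v : zn) yu => hu v (mem_behead (s := x :: u) yu)).
by exists (k :: l); [rewrite /= -ul xk|rewrite word_cons big_cons el xk].
Qed.

Lemma len_affP w : Waff w -> exists l, [/\ w = word l, len_aff R w = size l
  & forall l', w = word l' -> (len_aff R w <= size l')%N].
Proof.
move=> hw; have [l0 e0] := Waff_word m_gt0 hw.
pose A k := (exists2 u, is_word_of R w u & size u = k) /\
  forall u, is_word_of R w u -> (k <= size u)%N.
have [k Ak] : exists k, A k.
  pose Q k := `[< exists2 l, w = word l & size l = k >].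
  have exQ : exists k, Q k by exists (size l0); apply/asboolP; exists l0.
  case: (ex_minnP exQ) => k /asboolP[l e sl] kmin; exists k; split.
    by exists [seq s k | k <- l]; rewrite ?size_map //; apply/is_word_ofP; exists l.
  move=> u /is_word_ofP[l' -> e']; rewrite size_map; apply: kmin.
  by apply/asboolP; exists l'.
have : A (len_aff R w) by rewrite /len_aff; case: xgetP => [|/(_ k)//] ? ->.
case=> -[u /is_word_ofP[l ul e] su] hmin; exists l; split=> //.
  by rewrite -su ul size_map.
move=> l' e'; rewrite -(size_map s); apply: hmin; apply/is_word_ofP.
by exists l'.
Qed.

Lemma ostep_len w g : Waff w -> ostep (@pos m) w g ->
  (len_aff R w < len_aff R g)%N /\ exists2 t, affine_refl R t & g = (w * t)%g.
Proof.
move=> hw [r [hr pr ge]]; have Ww := Waff_Wext hw.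
have hg : Waff g by rewrite ge; apply: WaffM => //; exact: refl_Waff.
have [l [el sl _]] := len_affP hg.
have pg : pos r != pos (root_act (word l)^-1%g r).
  rewrite -el ge invMg root_actM refl_inv // pos_refl //; last exact: WextV.
  by rewrite pr; case: pos.
have [[l' l'l e'] [k [v [hv ev]]]] := exchange m_gt0 hr pg; split.
  rewrite sl; apply: leq_ltn_trans l'l.
  have [_ [_ _ h]] := len_affP hw; apply: h.
  by rewrite -e' -el ge mulgA refl_sq // mul1g.
exists (w^-1 * refl r * w)%g; last by rewrite !mulgA mulgV mul1g.
exists (s k), (w^-1 * v)%g; split.
- exact: srefl_is_simple.
- by apply: WaffM => //; exact: WaffV.
- by rewrite ev invMg invgK !mulgA.
Qed.

Lemma affine_refl_root t : affine_refl R t -> exists2 r, isroot r & t = refl r.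
Proof.
move=> [_ [w [/simple_reflP[k ->] hw ->]]]; have hk := sroot_root m_gt0 k.
have Ww := Waff_Wext hw; exists (root_act w (f k)); first by rewrite isroot_Wext.
by rewrite refl_conj.
Qed.

Lemma ole_bruhat_aff w g : Waff w -> bruhat_aff R w g <-> w <=B g.
Proof.
move=> hw; split=> h.
  elim: h => {w hw g} [w g [hw lt [t /affine_refl_root[r0 hr0 ->] e]]|w|w v g _ h1 _ h2];
    [|exact: rt_refl|exact: rt_trans h1 h2].
  have Ww := Waff_Wext hw; set r := root_act w r0.
  have hr : isroot r by rewrite isroot_Wext.
  have {}e : g = (refl r * w)%g by rewrite e refl_conj // mulgVK.
  have [pe|pne] := eqVneq (pos r) (pos (root_act w^-1%g r)).
    by apply: rt_step; exists r.
  have hg : Waff g by rewrite e; apply: WaffM => //; exact: refl_Waff.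
  (* With unequal signs the reflection leads upward from [g] to [w], which contradicts the
     lengths. *)
  have st : ostep (@pos m) g w.
    exists r; split=> //; last by rewrite e mulgA refl_sq // mul1g.
    rewrite e invMg root_actM refl_inv // pos_refl //; last exact: WextV.
    by move: pne; case: (pos r); case: (pos _).
  by have [lt' _] := ostep_len hg st; move: (ltn_trans lt lt'); rewrite ltnn.
elim: h hw => {w g} [w g st hw|w|w v g h0 h1 _ h2 hw].
- by apply: rt_step; have [lt at_] := ostep_len hw st; split.
- by move=> _; exact: rt_refl.
- apply: rt_trans (h1 hw) (h2 _).
  elim: h0 hw => {w v h1 h2} // [w v [r [hr _ ->]] hw|w v u _ i1 _ i2 hw].
    by apply: WaffM => //; exact: refl_Waff.
  by apply: i2; exact: i1.
Qed.

Lemma OmegaP w : Omega R w <-> Wext w /\ forall r, isroot r -> pos (root_act w r) = pos r.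
Proof.
have hb := basept_balanced m_gt0 R.
split=> -[hw].
  move=> e; split=> // r hr; have hw' := WextV hw.
  have [x /(base_alcoveE m_gt0)[hx fx] xb] : (zaff_act w @` base_alcove R m) (basept m R).
    by rewrite e base_alcove_facet //; exact: facet_of_self.
  have hwr : isroot (root_act w r) by rewrite isroot_Wext.
  have ax : facet_of (basept m R) x.
    by rewrite -base_alcove_facet //; apply/(base_alcoveE m_gt0).
  by rewrite !(posE R) -{1}xb rval_act (facet_of_gt0 ax).
move=> pw; split=> //.
have key g x : Wext g -> (forall r, isroot r -> pos (root_act g r) = pos r) ->
    base_alcove R m x -> base_alcove R m (zaff_act g x).
  move=> hg pg /(base_alcoveE m_gt0)[hx fx]; apply/(base_alcoveE m_gt0).
  split=> [|k]; first exact: balanced_act.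
  have hk := sroot_root m_gt0 k; have hg' := WextV hg.
  rewrite rval_actV (open_alcove_pos m_gt0 hx fx) ?isroot_Wext //.
  by rewrite -pg ?isroot_Wext // root_actVK sroot_pos.
apply/seteqP; split=> x; first by case=> y hy <-; exact: key.
move=> hx; exists (zaff_act w^-1%g x); last by rewrite -zaff_actM mulgV zaff_act1.
apply: key => // [|r hr]; first exact: WextV.
by rewrite -pw ?root_actVK // isroot_Wext //; exact: WextV.
Qed.

Lemma Wext_decomp w : Wext w -> exists v t, [/\ Waff v, Omega R t & w = (v * t)%g].
Proof.
have [N] := ubnP (displ_norm w); elim: N w => // N IH w Nw hw.
have [[k hk]|pw] := simple_descent m_gt0 hw.
  have [v [t [hv ht e]]] :=
    IH _ (leq_trans (srefl_displ m_gt0 hw hk) Nw) (WextM (srefl_Wext m_gt0 k) hw).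
  exists (s k * v)%g, t; split=> //; first by apply: WaffM => //; exact: srefl_Waff.
  by rewrite -mulgA -e srefl_mulK.
by exists 1%g, w; split; [exact: Waff1|apply/OmegaP|rewrite mul1g].
Qed.

Lemma Omega_Wext t : Omega R t -> Wext t. Proof. by case. Qed.

Lemma OmegaV t : Omega R t -> forall r, isroot r -> pos (root_act t^-1%g r) = pos r.
Proof.
move=> /OmegaP[ht pt] r hr; rewrite -pt ?root_actVK // isroot_Wext //; exact: WextV.
Qed.

Lemma decomp_unique v t v' t' : Waff v -> Waff v' -> Omega R t -> Omega R t' ->
  (v * t = v' * t')%g -> v = v' /\ t = t'.
Proof.
move=> hv hv' ht ht' e.
have e1 : (v'^-1 * v = t' * t^-1)%g.
  by apply: (@mulIg _ t); rewrite mulgVK -mulgA e mulKg.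
have v1 : (v'^-1 * v)%g = 1%g.
  apply: (Waff_pos_id m_gt0); first by apply: WaffM => //; exact: WaffV.
  move=> k; have hk := sroot_root m_gt0 k; have [Wt pt] := (OmegaP t').1 ht'.
  rewrite e1 root_actM pt ?(OmegaV ht) ?sroot_pos // isroot_Wext //.
  by apply: WextV; exact: Omega_Wext.
have vv : v = v' by rewrite -[v](mulVKg v') v1 mulg1.
by split=> //; move: e; rewrite vv => /mulgI.
Qed.

Lemma bruhatP w g : Wext w -> bruhat R w g <-> w <=B g.
Proof.
move=> hw; split=> [[v [v' [t [hv hv' ht [we ge] /(ole_bruhat_aff _ hv) le]]]]|le].
  have [Wt pt] := (OmegaP t).1 ht.
  by rewrite we ge; apply: ole_Omega_mulr => //; exact: Waff_Wext.
have [v [t [hv ht e]]] := Wext_decomp hw.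
have [Wt pt] := (OmegaP t).1 ht.
have le' : v <=B (g * t^-1)%g.
  rewrite -[v](mulgK t) -e; apply: ole_Omega_mulr => //; first exact: WextV.
  exact: OmegaV.
exists v, (g * t^-1)%g, t; split=> //; last exact/ole_bruhat_aff.
  elim: le' hv => // {w g hw le e v t ht Wt pt} [w g [r [hr _ ->]] hw|w v u _ i1 _ i2 hw].
    by apply: WaffM => //; exact: refl_Waff.
  by apply: i2; exact: i1.
by rewrite mulgVK.
Qed.

Lemma lenE v t : Waff v -> Omega R t -> len R (v * t)%g = len_aff R v.
Proof.
move=> hv ht; rewrite /len; case: xgetP => [k ->|/(_ (len_aff R v))[]]; last first.
  by exists v, t.
by move=> [v' [t' [hv' ht' e ->]]]; have [-> _] := decomp_unique hv hv' ht ht' e.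
Qed.

Lemma ole_len w g : Wext w -> w <=B g -> (len R w <= len R g)%N.
Proof.
move=> hw h; elim: h hw => {w g} [w g|//|w v g h0 h1 _ h2 hw]; last first.
  by apply: leq_trans (h1 hw) (h2 _); exact: ole_Wext h0 hw.
move=> [r [hr pr ->]] hw; have [v [t [hv ht e]]] := Wext_decomp hw.
have hrv : Waff (refl r * v)%g by apply: WaffM => //; exact: refl_Waff.
rewrite e mulgA !lenE //; apply: ltnW.
have hvr : isroot (root_act v^-1%g r) by rewrite isroot_Wext //; apply/WextV/Waff_Wext.
have st : ostep (@pos m) v (refl r * v)%g.
  by exists r; split=> //; rewrite pr e invMg root_actM (OmegaV ht).
by have [] := ostep_len hv st.
Qed.

End Interface.

(** * Admissible double cosets *)

Section Admissible.
Variables (R : realType) (m : nat).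
Hypothesis m_gt0 : (0 < m)%N.
Local Notation n := m.*2.+1.
Local Notation zn := (zaff n).
Local Notation s := (@srefl m).
Local Notation f := (@sroot m).
Local Notation rowR := 'rV[R]_n.
Local Notation "x <=B y" := (ole (@pos m) x y) (at level 70).
Local Open Scope classical_set_scope.
Implicit Types (w g a b : zn) (p x y z : rowR) (D : set zn).
Hint Resolve ole_refl : core.

Lemma fixer_sub p p' w : in_closed_alcove p' -> apt p ->
  (forall k, rval (f k) p' = 0 -> rval (f k) p = 0) -> fixer p' w -> fixer p w.
Proof.
move=> hp' hp h; move: w; apply: (fixer_srefl_ind m_gt0 hp') => [|k w fk _ hw].
  exact: fixer1.
by apply: fixerM => //; apply: srefl_fixer => //; exact: h.
Qed.

Lemma same_side_closed x y : in_closed_alcove x -> in_closed_alcove y ->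
  (forall k, rval (f k) x = 0 <-> rval (f k) y = 0) -> same_side x y.
Proof.
move=> hx hy xy; apply/same_sideP => r hr.
have key r0 : isroot r0 -> pos r0 -> Num.sg (rval r0 x) = Num.sg (rval r0 y).
  move=> h0 p0; have x0 := closed_alcove_pos m_gt0 hx h0 p0.
  have y0 := closed_alcove_pos m_gt0 hy h0 p0.
  have xyr : rval r0 x = 0 -> rval r0 y = 0.
    by apply: (root_vanish m_gt0 hx hy.1) => // k /xy.
  have yxr : rval r0 y = 0 -> rval r0 x = 0.
    by apply: (root_vanish m_gt0 hy hx.1) => // k /xy.
  have [e|ne] := eqVneq (rval r0 x) 0; first by rewrite (xyr e) e.
  have ne' : rval r0 y != 0 by apply: contraNneq ne => /yxr->.
  by rewrite !gtr0_sg // lt_def ?ne ?ne'.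
case: (boolP (pos r)) => pr; first exact: key.
have := key (rneg r); rewrite isroot_neg pos_neg // => /(_ hr pr).
by rewrite !rval_neg !sgrN => /oppr_inj.
Qed.

Lemma facet_of_same x y : apt x -> apt y -> same_side x y -> facet_of x = facet_of y.
Proof.
move=> hx hy /same_sideP xy; apply/seteqP; split=> z [hz /same_sideP h];
  by split=> //; apply/same_sideP => r hr; rewrite -h // xy.
Qed.

(** Every wall through [p] differs from wall k and so contains the opposite vertex. A facet below
    that vertex lies on all walls except k, and cannot lie on wall k as well. *)
Lemma vertex_minimal_subfacet p k : in_closed_alcove p -> 0 < rval (f k) p ->
  is_minimal_subfacet (facet_of (vertex R k)) (facet_of p).
Proof.
move=> hp fk; have hv := vertex_closed m_gt0 R k; have av := hv.1; split.
- by exists (vertex R k).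
- apply: subfacet_of_closed => // j fj; apply: vertex_neq => //.
  by apply: contraTneq fk => <-; rewrite fj ltxx.
- move=> _ [x hx ->] sub; have cx := subfacet_closed m_gt0 hx hv sub.
  have fx j : j != k -> rval (f j) x = 0.
    move=> jk; apply: (subfacet_eq0 hx sub); rewrite ?sroot_root //.
    exact: vertex_neq.
  have fkx : rval (f k) x <> 0.
    have [j] := exists_sroot_gt0 m_gt0 cx; have [->|/fx->] := eqVneq j k; last by rewrite ltxx.
    by move=> h e; rewrite e ltxx in h.
  apply: facet_of_same => //; apply: same_side_closed => // j.
  have [->|jk] := eqVneq j k; last by rewrite fx // vertex_neq.
  split=> // e; have := vertex_gt0 m_gt0 R k.
  by rewrite e leNgt invr_gt0 ltr0n.
Qed.

Lemma dcosetP p1 p2 w g : in_closed_alcove p1 -> in_closed_alcove p2 ->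
  dcoset (facet_of p1) (facet_of p2) w g <->
  exists a b, [/\ fixer p1 a, fixer p2 b & g = (a * w * b)%g].
Proof.
by move=> h1 h2; split=> -[a [b [ha hb e]]]; exists a, b; split=> //; exact/facet_stabE.
Qed.

Lemma dcoset_refl p1 p2 w : in_closed_alcove p1 -> in_closed_alcove p2 ->
  dcoset (facet_of p1) (facet_of p2) w w.
Proof.
move=> h1 h2; apply/dcosetP => //; exists 1%g, 1%g.
by rewrite mul1g mulg1; split=> //; exact: fixer1.
Qed.

Lemma double_minimal_is_min_length p1 p2 w d : in_closed_alcove p1 -> in_closed_alcove p2 ->
  Wext d -> left_minimal p1 d -> right_minimal p2 d ->
  dcoset (facet_of p1) (facet_of p2) w d ->
  is_min_length R (dcoset (facet_of p1) (facet_of p2) w) d.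
Proof.
move=> h1 h2 hd l1 l2 Dd; split=> // g /dcosetP-/(_ h1 h2)[a [b [ha hb ->]]].
have [a' [b' [ha' hb' e]]] := (dcosetP _ _ h1 h2).1 Dd.
apply: (ole_len R m_gt0 hd).
have := double_minimal_le m_gt0 h1 h2 hd l1 l2
  (fixerM ha (fixerV ha')) (fixerM (fixerV hb') hb).
by rewrite {2}e !mulgA mulgVK -!mulgA mulVKg.
Qed.

(** Frees the order from minimal representatives: the projections on both sides carry a comparison
    at one representative of the larger coset to any other. *)
Lemma dcoset_bruhatP p1 p2 w g : in_closed_alcove p1 -> in_closed_alcove p2 ->
  Wext w -> Wext g ->
  dcoset_bruhat R (dcoset (facet_of p1) (facet_of p2) w) (dcoset (facet_of p1) (facet_of p2) g)
  <-> exists2 v, dcoset (facet_of p1) (facet_of p2) w v & v <=B g.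
Proof.
move=> h1 h2 hw hg; split.
  move=> [v [v' [[/dcosetP-/(_ h1 h2)[a [b [ha hb ve]]] _]
    [/dcosetP-/(_ h1 h2)[a' [b' [ha' hb' ve']]] _]]]].
  have hv : Wext v.
    by rewrite ve; apply: WextM (fixer_Wext hb); apply: WextM (fixer_Wext ha) hw.
  move=> /(bruhatP R m_gt0 _ hv) le.
  have [c hc le1] := project_left m_gt0 h1 hv (fixerV ha') le.
  have hcv := WextM (fixer_Wext hc) hv.
  have [d hd le2] := project_right m_gt0 h2 hcv (fixerV hb') le1.
  exists (c * v * d)%g; last by move: le2; rewrite ve' -!mulgA mulKg mulgV mulg1.
  apply/dcosetP => //; exists (c * a)%g, (b * d)%g; split; try exact: fixerM.
  by rewrite ve !mulgA.
move=> [v /dcosetP-/(_ h1 h2)[a [b [ha hb ve]]] le].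
have hv : Wext v.
    by rewrite ve; apply: WextM (fixer_Wext hb); apply: WextM (fixer_Wext ha) hw.
have [a' [b' [ha' hb' l' r' le']]] := descend_minimal m_gt0 h1 h2 hg.
have [c hc le1] := project_left m_gt0 h1 hv ha' le.
have hcv := WextM (fixer_Wext hc) hv.
have [d hd le2] := project_right m_gt0 h2 hcv hb' le1.
have hcvd := WextM hcv (fixer_Wext hd).
have [a1 [b1 [ha1 hb1 l1 r1 le3]]] := descend_minimal m_gt0 h1 h2 hcvd.
have hx := WextM (WextM (fixer_Wext ha1) hcvd) (fixer_Wext hb1).
have hy := WextM (WextM (fixer_Wext ha') hg) (fixer_Wext hb').
exists (a1 * (c * v * d) * b1)%g, (a' * g * b')%g; split.
- apply: double_minimal_is_min_length => //; apply/dcosetP => //.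
  exists (a1 * c * a)%g, (b * d * b1)%g; split; try by do !apply: fixerM.
  by rewrite ve !mulgA.
- apply: double_minimal_is_min_length => //; apply/dcosetP => //.
  by exists a', b'.
- apply/(bruhatP R m_gt0 _ hx); exact: ole_trans le3 le2.
Qed.

Lemma AdmP p1 p2 (mu : 'rV[int]_n) D : in_closed_alcove p1 -> in_closed_alcove p2 ->
  balanced int m mu ->
  Adm (facet_of p1) (facet_of p2) mu D <->
  dcosets (facet_of p1) (facet_of p2) D /\
  exists w (t : 'S_n), [/\ D w, Sstar t & w <=B transl (permv t mu)].
Proof.
move=> h1 h2 hmu; have Wt (t : 'S_n) : Sstar t -> Wext (transl (permv t mu)).
  by move=> ht; apply/transl_Wext/balanced_perm.
split=> -[[w hw ->]].
  move=> [t ht /(dcoset_bruhatP h1 h2 hw (Wt t ht))[v Dv le]].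
  by split; [exists w|exists v, t].
move=> [v [t [Dv ht le]]]; split; first by exists w.
by exists t => //; apply/dcoset_bruhatP => //; [exact: Wt|exists v].
Qed.

Theorem Adm_AdmVert (mu : 'rV[int]_n) (F F' : set rowR) : balanced int m mu ->
  is_facet F -> is_facet F' -> subfacet F F' -> subfacet F' (base_alcove R m) ->
  Adm F' F mu = AdmVert F' F mu.
Proof.
move=> hmu [p ap ->] [p' ap' ->]; rewrite -!/(facet_of _) => FF' F'A.
have hp' := subfacet_base_closed m_gt0 ap' F'A.
have hp := subfacet_closed m_gt0 ap hp' FF'.
have pp' k : rval (f k) p' = 0 -> rval (f k) p = 0.
  by apply: (subfacet_eq0 ap FF'); exact: sroot_root.
apply/seteqP; split=> D.
  move=> /(AdmP _ hp' hp hmu)[[w hw De] [g [t [Dg ht le]]]]; split; first by exists w.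
  move=> _ [[v av ->] vF _] /=; rewrite -/(facet_of v) in vF *.
  have hv := subfacet_closed m_gt0 av hp vF.
  have pv k : rval (f k) p = 0 -> rval (f k) v = 0.
    by apply: (subfacet_eq0 av vF); exact: sroot_root.
  apply/AdmP => //; split; last first.
    by exists g, t; split=> //; exists g => //; exact: dcoset_refl.
  exists w => //; apply/seteqP; split=> z.
    move=> [u]; rewrite De => /dcosetP-/(_ hp' hp)[a [b [ha hb ->]]].
    move=> /dcosetP-/(_ hv hv)[c [d [hc hd ->]]].
    apply/dcosetP => //; exists (c * a)%g, (b * d)%g; split; last by rewrite !mulgA.
      by apply: fixerM => //; apply: fixer_sub ha => // k /pp'/pv.
    by apply: fixerM => //; exact: fixer_sub hb.
  by move=> wz; exists w; rewrite // De; exact: dcoset_refl.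
move=> [[w hw De] Dv]; apply/AdmP => //; split; first by exists w.
(* A representative without right descents in the fixer of [p] is what the vertexwise theorem
   requires; the left side needs no choice, since the fixer of [p'] lies in each vertex fixer. *)
have [a [b [ha hb _ xmin _]]] := descend_minimal m_gt0 hp' hp hw.
have hx := WextM (WextM (fixer_Wext ha) hw) (fixer_Wext hb).
set x := (a * w * b)%g in xmin hx.
have [t ht le] : exists2 t : 'S_n, Sstar t & x <=B transl (permv t mu).
  apply: (vertexwise_admissible m_gt0 hp hmu hx xmin) => k fk.
  have hv := vertex_closed m_gt0 R k.
  have pv j : rval (f j) p = 0 -> rval (f j) (vertex R k) = 0.
    move=> fj; apply: vertex_neq => //.
    by apply: contraTneq fk => <-; rewrite fj ltxx.
  have p'v u : fixer p' u -> fixer (vertex R k) u.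
    by apply: fixer_sub => //; [exact: hv.1|move=> j /pp'/pv].
  have pv' u : fixer p u -> fixer (vertex R k) u by apply: fixer_sub => //; exact: hv.1.
  have := Dv _ (vertex_minimal_subfacet hp fk); rewrite /preimage /=.
  move=> /(AdmP _ hv hv hmu)[_ [g [t [[u Du ug] ht le]]]].
  move: Du ug; rewrite De => /dcosetP-/(_ hp' hp)[a' [b' [ha' hb' ->]]].
  move=> /dcosetP-/(_ hv hv)[c [d [hc hd ge]]].
  exists (c * a' * a^-1)%g, (b^-1 * b' * d)%g, t; split=> //.
  - by do 2?apply: fixerM => //; [exact: p'v|exact/fixerV/p'v].
  - by do 2?apply: fixerM => //; [exact/fixerV/pv'|exact: pv'].
  - suff -> : (c * a' * a^-1 * x * (b^-1 * b' * d))%g = g by [].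
    by rewrite ge /x !mulgA mulgVK mulgK.
exists x, t; split=> //; rewrite De; apply/dcosetP => //.
by exists a, b.
Qed.

End Admissible.

Lemma mu_q_balanced m q : (q <= m)%N -> balanced int m (mu_q m q).
Proof.
move=> qm i; have Hi := ltn_ord i; rewrite !mxE val_mid /=.
have -> : (m < q)%N = false by lia.
have -> : (m < m.*2.+1 - q)%N by lia.
have [iq|iq] := ltnP i q.
  have -> : (m.*2.+1 - i.+1 < q)%N = false by lia.
  by have -> : (m.*2.+1 - i.+1 < m.*2.+1 - q)%N = false by lia.
have [iq'|iq'] := ltnP i (m.*2.+1 - q).
  have -> : (m.*2.+1 - i.+1 < q)%N = false by lia.
  by have -> : (m.*2.+1 - i.+1 < m.*2.+1 - q)%N by lia.
by have -> : (m.*2.+1 - i.+1 < q)%N by lia.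
Qed.

Theorem theorem9p7p1 (R : realType) (m q : nat)
    (m_ge1 : (1 <= m)%N) (q_le_m : (q <= m)%N)
    (F F' : set 'rV[R]_(m.*2.+1))
    (facetF : is_facet F) (facetF' : is_facet F')
    (FF' : subfacet F F') (F'A : subfacet F' (base_alcove R m)) :
  Adm F' F (mu_q m q) = AdmVert F' F (mu_q m q).
Proof. by apply: Adm_AdmVert => //; exact: mu_q_balanced. Qed.
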